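(* Let $(\mathcal G,\mathcal Y)$ be a graph of hyperbolic groups with the qi embedded condition such that $\pi_1(\mathcal G,\mathcal Y)$ is hyperbolic. Let $(\mathcal G',\mathcal Y')$ be a subgraph of subgroups of $(\mathcal G,\mathcal Y)$ satisfying the qi embedded condition. Suppose moreover that: (1) $\mathcal Y'=\mathcal Y$; (2) for each vertex $\mathfrak u$ of $\mathcal Y'$, the vertex group $G'_{\mathfrak u}$ of $(\mathcal G',\mathcal Y')$ is a quasiconvex subgroup of $G_{\mathfrak u}$; (3) for each edge $\mathfrak e$ of $\mathcal Y'$, $G'_{\mathfrak e}=G_{\mathfrak e}$. If $\pi_1(\mathcal G',\mathcal Y')$ is weakly malnormal in $\pi_1(\mathcal G,\mathcal Y)$, then $\pi_1(\mathcal G',\mathcal Y')$ is quasiconvex in $\pi_1(\mathcal G,\mathcal Y)$.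
   Context: All graphs of groups are over finite connected graphs. A graph of groups $(\mathcal G,\mathcal Y)$ assigns a vertex group $G_{\mathfrak v}$ to each vertex, an edge group $G_{\mathfrak e}$ to each edge, and an injective incidence homomorphism $G_{\mathfrak e}\to G_{\mathfrak v}$ for each endpoint $\mathfrak v$ of $\mathfrak e$; $\pi_1(\mathcal G,\mathcal Y)$ is its fundamental group (Bass--Serre theory). It is a graph of hyperbolic groups with the qi embedded condition if all vertex and edge groups are Gromov hyperbolic and all incidence homomorphisms are quasi-isometric (qi) embeddings (word metrics for finite generating sets). A subgraph of subgroups $(\mathcal G',\mathcal Y')$ of $(\mathcal G,\mathcal Y)$ consists of a connected subgraph $\mathcal Y'\subseteq\mathcal Y$ and subgroups $G'_{\mathfrak v}<G_{\mathfrak v}$, $G'_{\mathfrak e}<G_{\mathfrak e}$ for the vertices $\mathfrak v$ and edges $\mathfrak e$ of $\mathcal Y'$, such that the restrictions of the incidence homomorphisms make this a graph of groups, and such that the induced map of Bass--Serre trees is injective. (Then the natural homomorphism $\pi_1(\mathcal G',\mathcal Y')\to\pi_1(\mathcal G,\mathcal Y)$ is injective and $\pi_1(\mathcal G',\mathcal Y')$ is regarded as a subgroup.) ''With the qi embedded condition'' means that $(\mathcal G',\mathcal Y')$ is itself a graph of hyperbolic groups with the qi embedded condition. A subgroup $A$ of a group $B$ is weakly malnormal if $A\cap gAg^{-1}$ is finite for all $g\in B\setminus A$. *)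

(* Defs.v *)
From HB Require Import structures.
From Stdlib Require Import Relations.
From mathcomp Require Import all_boot all_order all_algebra.
From mathcomp Require Import generic_quotient.
From mathcomp Require Import boolp classical_sets functions cardinality.

Set Implicit Arguments.
Unset Strict Implicit.
Unset Printing Implicit Defensive.

Import Order.TTheory GRing.Theory Num.Theory.
Local Open Scope classical_set_scope.
Local Open Scope group_scope.

Record subgroup (G : groupType) := Subgroup {
  subgroup_set :> set G;
  subgroup_closed : group_closed (mem subgroup_set) }.

Definition subgroup_type (G : groupType) (H : subgroup G) : Type :=
  {x : G | x \in mem (subgroup_set H)}.

Section SubgroupType.
Context (G : groupType) (H : subgroup G).
HB.instance Definition _ := SubChoice.on (subgroup_type H).
HB.instance Definition _ :=
  SubChoice_isSubGroup.Build G (mem (subgroup_set H)) (subgroup_type H)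
    (subgroup_closed H).
End SubgroupType.

Lemma subgroup_memP (G : groupType) (H : subgroup G) (x : subgroup_type H) :
  subgroup_set H (val x).
Proof. by have := valP x; rewrite inE. Qed.

Section WordMetric.
Context (G : groupType).

Definition has_word (S : set G) (g : G) (n : nat) : Prop :=
  exists w : seq G, [/\ forall x, x \in w -> S x \/ S x^-1,
    size w = n & \prod_(x <- w) x = g].

Definition finite_generating (S : set G) : Prop :=
  finite_set S /\ forall g, exists n, has_word S g n.

(* Junk value 0 when [g] is not in the subgroup generated by [S]. *)
Definition word_length (S : set G) (g : G) : nat :=
  xget 0%N [set n | has_word S g n /\ forall m, has_word S g m -> (n <= m)%N].

Definition word_dist (S : set G) (x y : G) : nat := word_length S (x^-1 * y).

End WordMetric.

Section CoarseGeometry.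
Local Open Scope ring_scope.

Definition gromov_product (T : Type) (d : T -> T -> nat) (w x y : T) : rat :=
  ((d x w)%:R + (d y w)%:R - (d x y)%:R) / 2%:R.

Definition gromov_hyperbolic (T : Type) (d : T -> T -> nat) : Prop :=
  exists delta : rat, forall w x y z : T,
    Num.min (gromov_product d w x y) (gromov_product d w y z) - delta
      <= gromov_product d w x z.

Definition qi_embedding_dist (T U : Type) (d : T -> T -> nat)
    (d' : U -> U -> nat) (f : T -> U) : Prop :=
  exists K C : rat, [/\ 1 <= K, 0 <= C & forall x y : T,
    K^-1 * (d x y)%:R - C <= (d' (f x) (f y))%:R <= K * (d x y)%:R + C].

Definition geodesic (T : Type) (d : T -> T -> nat) (n : nat) (p : nat -> T) :
    Prop :=
  forall i j : nat, (i <= j <= n)%N -> d (p i) (p j) = (j - i)%N.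

Definition quasiconvex_dist (T : Type) (d : T -> T -> nat) (A : set T) : Prop :=
  exists K : nat, forall (n : nat) (p : nat -> T),
    geodesic d n p -> A (p 0%N) -> A (p n) ->
    forall i : nat, (i <= n)%N -> exists2 a, A a & (d (p i) a <= K)%N.

End CoarseGeometry.

Definition hyperbolic_group (G : groupType) : Prop :=
  exists2 S : set G, finite_generating S & gromov_hyperbolic (word_dist S).

Definition qi_embedding (G H : groupType) (f : G -> H) : Prop :=
  exists (S : set G) (T : set H), [/\ finite_generating S,
    finite_generating T & qi_embedding_dist (word_dist S) (word_dist T) f].

(* For hyperbolic [G] the choice of generating set does not matter. *)
Definition quasiconvex (G : groupType) (A : set G) : Prop :=
  exists2 S : set G, finite_generating S & quasiconvex_dist (word_dist S) A.

Definition weakly_malnormal (G : groupType) (A : set G) : Prop :=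
  forall g : G, ~ A g -> finite_set (A `&` [set g * a * g^-1 | a in A]).

(* An unoriented edge [e] has two ends, indexed by [bool]; the pair [(e, b)]
   is [e] oriented from [endpt e b] to [endpt e (~~ b)]. *)
Record graph := Graph {
  vert : Type;
  edge : Type;
  endpt : edge -> bool -> vert }.
Arguments endpt {g}.

Definition finite_graph (Y : graph) : Prop :=
  finite_set [set: vert Y] /\ finite_set [set: edge Y].

Definition connected (Y : graph) : Prop :=
  inhabited (vert Y) /\
  forall u v : vert Y, clos_refl_sym_trans (vert Y)
    (fun a b => exists e : edge Y, a = endpt e false /\ b = endpt e true) u v.

Record graph_morphism (X Y : graph) := GraphMorphism {
  vmap : vert X -> vert Y;
  emap : edge X -> edge Y;
  endpt_map : forall e b, vmap (endpt e b) = endpt (emap e) b }.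

Definition injective_graph_morphism (X Y : graph) (f : graph_morphism X Y) :
  Prop := injective (vmap f) /\ injective (emap f).

Record subgraph (Y : graph) := Subgraph {
  subvert : set (vert Y);
  subedge : set (edge Y);
  subgraph_closed : forall e b, subedge e -> subvert (endpt e b) }.

Definition graph_of_subgraph (Y : graph) (Y' : subgraph Y) : graph :=
  @Graph (set_type (subvert Y')) (set_type (subedge Y'))
    (fun e b => exist _ (endpt (sval e) b)
      (mem_set (subgraph_closed b (set_mem (svalP e))))).
Coercion graph_of_subgraph : subgraph >-> graph.

Record graph_of_groups (Y : graph) := GraphOfGroups {
  vgroup : vert Y -> groupType;
  egroup : edge Y -> groupType;
  inc : forall (e : edge Y) (b : bool),
    UMagmaMorphism.type (egroup e) (vgroup (endpt e b));
  inc_inj : forall e b, injective (inc e b) }.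

Definition qi_embedded_condition (Y : graph) (G : graph_of_groups Y) : Prop :=
  [/\ forall v, hyperbolic_group (vgroup G v),
      forall e, hyperbolic_group (egroup G e) &
      forall e b, qi_embedding (inc G e b)].

Section FundamentalGroup.
Context (Y : graph) (G : graph_of_groups Y).

Definition letter : Type := {v : vert Y & vgroup G v} + edge Y * bool.
HB.instance Definition _ := gen_eqMixin letter.
HB.instance Definition _ := gen_choiceMixin letter.

Definition vl (v : vert Y) (g : vgroup G v) : letter := inl (existT _ v g).
Definition el (e : edge Y) (b : bool) : letter := inr (e, b).

Definition letter_src (l : letter) : vert Y :=
  match l with inl s => projT1 s | inr (e, b) => endpt e b end.
Definition letter_tgt (l : letter) : vert Y :=
  match l with inl s => projT1 s | inr (e, b) => endpt e (~~ b) end.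
Definition letter_inv (l : letter) : letter :=
  match l with inl s => vl (projT2 s)^-1 | inr (e, b) => el e (~~ b) end.

(* Defining relations of Serre's group F(G, Y), which is generated by the vertex
   groups and the oriented edges; [inc G e b] lands in the group of the origin
   of [(e, b)]. *)
Inductive relator : seq letter -> seq letter -> Prop :=
| rel_one v : relator [:: vl (1 : vgroup G v)] [::]
| rel_mul v (g h : vgroup G v) : relator [:: vl g; vl h] [:: vl (g * h)]
| rel_inv e b : relator [:: el e b; el e (~~ b)] [::]
| rel_edge e b (a : egroup G e) :
    relator [:: el e b; vl (inc G e (~~ b) a); el e (~~ b)]
            [:: vl (inc G e b a)].

Inductive rewrites : seq letter -> seq letter -> Prop :=
| rewrites_ctx p q s t : relator s t -> rewrites (p ++ s ++ q) (p ++ t ++ q).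

Definition word_equiv : seq letter -> seq letter -> Prop :=
  clos_refl_sym_trans _ rewrites.

Definition word_equivb (u v : seq letter) : bool := `[< word_equiv u v >].

Lemma word_equiv_refl : reflexive word_equivb.
Proof. by move=> u; apply/asboolP/rst_refl. Qed.
Lemma word_equiv_sym : symmetric word_equivb.
Proof. by move=> u v; apply/asboolP/asboolP => h; apply: rst_sym. Qed.
Lemma word_equiv_trans : transitive word_equivb.
Proof.
by move=> v u w /asboolP uv /asboolP vw; apply/asboolP; apply: rst_trans vw.
Qed.
Canonical word_equiv_rel :=
  EquivRel word_equivb word_equiv_refl word_equiv_sym word_equiv_trans.

Lemma relator_equiv s t : relator s t -> word_equiv s t.
Proof.
by move=> st; have := rewrites_ctx [::] [::] st; rewrite /= !cats0; apply: rst_step.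
Qed.

Lemma word_equiv_ctx p q u v :
  word_equiv u v -> word_equiv (p ++ u ++ q) (p ++ v ++ q).
Proof.
elim=> [_ _ [p' q' s t st]|w|w1 w2 _|w1 w2 w3 _ h1 _ h2].
- apply: rst_step; rewrite !catA -!(catA (p ++ p')) -!catA !(catA p p').
  exact: rewrites_ctx.
- exact: rst_refl.
- exact: rst_sym.
- exact: rst_trans h2.
Qed.

Lemma word_equiv_cat u u' v v' :
  word_equiv u u' -> word_equiv v v' -> word_equiv (u ++ v) (u' ++ v').
Proof.
move=> uu' vv'; apply: (@rst_trans _ _ _ (u' ++ v)).
  exact: (@word_equiv_ctx [::] v _ _ uu').
by have := @word_equiv_ctx u' [::] _ _ vv'; rewrite !cats0.
Qed.

Definition word_inv (w : seq letter) : seq letter := rev (map letter_inv w).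

Lemma letter_invV l : word_equiv [:: letter_inv l; l] [::].
Proof.
case: l => [[v g]|[e b]] /=.
  apply: rst_trans (relator_equiv (rel_mul _ _)) _.
  by rewrite /= mulVg; apply: relator_equiv (rel_one _).
by have := relator_equiv (rel_inv e (~~ b)); rewrite negbK.
Qed.

Lemma letter_invK : involutive letter_inv.
Proof. by case=> [[v g]|[e b]] /=; rewrite /vl /el ?invgK ?negbK. Qed.

Lemma word_invV w : word_equiv (word_inv w ++ w) [::].
Proof.
elim: w => [|l w IH]; first exact: rst_refl.
rewrite /word_inv /= rev_cons -cats1 -catA.
apply: rst_trans IH; have := word_equiv_ctx (word_inv w) w (letter_invV l).
by [].
Qed.

Lemma word_invK : involutive word_inv.
Proof. by move=> w; rewrite /word_inv map_rev revK (mapK letter_invK). Qed.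

(* Serre's group F(G, Y). *)
Definition path_group : Type := {eq_quot word_equiv_rel}%qT.
HB.instance Definition _ := Choice.on path_group.
HB.instance Definition _ := EqQuotient.on path_group.

Definition cls (w : seq letter) : path_group := (\pi w)%qT.

Lemma cls_eqP u v : cls u = cls v <-> word_equiv u v.
Proof. by split=> [/eqmodP/asboolP //|h]; apply/eqmodP/asboolP. Qed.

Lemma clsK x : cls (repr x) = x.
Proof. exact: reprK. Qed.

Lemma repr_cls w : word_equiv (repr (cls w)) w.
Proof. by apply/cls_eqP; rewrite clsK. Qed.

Definition pg_one : path_group := cls [::].
Definition pg_mul (x y : path_group) : path_group := cls (repr x ++ repr y).
Definition pg_inv (x : path_group) : path_group := cls (word_inv (repr x)).

Lemma pg_mulE u v : pg_mul (cls u) (cls v) = cls (u ++ v).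
Proof. by apply/cls_eqP/word_equiv_cat; apply: repr_cls. Qed.

Lemma pg_mulA : associative pg_mul.
Proof.
move=> x y z; rewrite -(clsK x) -(clsK y) -(clsK z).
by rewrite !pg_mulE catA.
Qed.
Lemma pg_mul1 : left_id pg_one pg_mul.
Proof. by move=> x; rewrite -(clsK x) pg_mulE. Qed.
Lemma pg_1mul : right_id pg_one pg_mul.
Proof. by move=> x; rewrite -(clsK x) pg_mulE cats0. Qed.
Lemma pg_mulV : left_inverse pg_one pg_inv pg_mul.
Proof.
move=> x; rewrite -{2}(clsK x) pg_mulE; apply/cls_eqP; exact: word_invV.
Qed.
Lemma pg_Vmul : right_inverse pg_one pg_inv pg_mul.
Proof.
move=> x; rewrite -{1}(clsK x) pg_mulE; apply/cls_eqP.
by rewrite -{1}(word_invK (repr x)); apply: word_invV.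
Qed.

HB.instance Definition _ :=
  isGroup.Build path_group pg_mulA pg_mul1 pg_1mul pg_mulV pg_Vmul.

Lemma clsM u v : cls (u ++ v) = cls u * cls v.
Proof. by rewrite -pg_mulE. Qed.

Lemma cls1 : cls [::] = 1.
Proof. by []. Qed.

Lemma clsV w : cls (word_inv w) = (cls w)^-1.
Proof.
apply: (mulIg (cls w)); rewrite mulVg -clsM; apply/cls_eqP; exact: word_invV.
Qed.

Definition vcls (v : vert Y) (g : vgroup G v) : path_group := cls [:: vl g].

Lemma vclsM v (g h : vgroup G v) : vcls (g * h) = vcls g * vcls h.
Proof. by rewrite /vcls -clsM; apply/esym/cls_eqP/relator_equiv/rel_mul. Qed.

Lemma vcls1 v : vcls (1 : vgroup G v) = 1.
Proof. exact/cls_eqP/relator_equiv/rel_one. Qed.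

Definition ecls (e : edge Y) (b : bool) : path_group := cls [:: el e b].

(* [is_path u w v]: the word [w] reads along a path from [u] to [v]; several
   consecutive letters may come from the same vertex group. *)
Fixpoint is_path (u : vert Y) (w : seq letter) (v : vert Y) : Prop :=
  match w with
  | [::] => u = v
  | l :: w' => letter_src l = u /\ is_path (letter_tgt l) w' v
  end.

Definition path_class (u v : vert Y) : set path_group :=
  [set x | exists2 w, is_path u w v & x = cls w].

Lemma is_path_cat u v t w1 w2 :
  is_path u w1 v -> is_path v w2 t -> is_path u (w1 ++ w2) t.
Proof. by elim: w1 u => [|l w1 IH] u /= => [->|[-> /IH h] /h]. Qed.

Lemma is_path_inv u v w : is_path u w v -> is_path v (word_inv w) u.
Proof.
elim: w u => [|l w IH] u /=; first by move->.
move=> [<- /IH h]; rewrite /word_inv /= rev_cons -cats1.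
apply: (is_path_cat h); case: l {h} => [[x g]|[e b]] //=.
by rewrite negbK.
Qed.

Lemma path_classM u v t x y :
  path_class u v x -> path_class v t y -> path_class u t (x * y).
Proof.
move=> [w1 h1 ->] [w2 h2 ->]; exists (w1 ++ w2); last by rewrite clsM.
exact: is_path_cat h2.
Qed.

Lemma path_class_vcls v (g : vgroup G v) : path_class v v (vcls g).
Proof. by exists [:: vl g]. Qed.

Lemma path_class_ecls e b : path_class (endpt e b) (endpt e (~~ b)) (ecls e b).
Proof. by exists [:: el e b]. Qed.

Lemma loops_closed v : group_closed (mem (path_class v v)).
Proof.
split; first by rewrite inE; exists [::].
move=> x y; rewrite !inE => xv [w hw ->].
apply: path_classM xv _; exists (word_inv w); last by rewrite clsV.
exact: is_path_inv.
Qed.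

Definition loops (v : vert Y) : subgroup path_group := Subgroup (loops_closed v).

Definition pi1 (v : vert Y) : groupType := subgroup_type (loops v).

(* Vertices over [v] (resp. edges over [e]) are the left cosets of
   [vgroup G v] (resp. of the image of [egroup G e] at [endpt e false]) in the
   set of classes of paths from the base vertex [v0] to [v] (resp. to
   [endpt e false]); for [v = v0] these are the elements of pi1 / G_v. *)
Definition vcoset (v : vert Y) (C : set path_group) : set path_group :=
  [set z | exists x (g : vgroup G v), C x /\ z = x * vcls g].
Definition ecoset (e : edge Y) (C : set path_group) : set path_group :=
  [set z | exists x (a : egroup G e), C x /\ z = x * vcls (inc G e false a)].

Definition tree_verts (v0 : vert Y) : set (vert Y * set path_group) :=
  [set vC | exists2 x, path_class v0 vC.1 x & vC.2 = vcoset vC.1 [set x]].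
Definition tree_edges (v0 : vert Y) : set (edge Y * set path_group) :=
  [set eC | exists2 x, path_class v0 (endpt eC.1 false) x &
                       eC.2 = ecoset eC.1 [set x]].

Definition tree_endpt_fun (eC : edge Y * set path_group) (b : bool) :
    vert Y * set path_group :=
  (endpt eC.1 b, vcoset (endpt eC.1 b)
     [set x * (if b then ecls eC.1 false else 1) | x in eC.2]).

Lemma inc_ecls e (a : egroup G e) :
  vcls (inc G e false a) * ecls e false = ecls e false * vcls (inc G e true a).
Proof.
have h : ecls e true * (vcls (inc G e false a) * ecls e false)
    = vcls (inc G e true a).
  rewrite /vcls /ecls -(clsM [:: _] [:: _]) -(clsM [:: _] [:: _; _]).
  exact/cls_eqP/relator_equiv/(rel_edge true a).
rewrite -h mulgA.
have -> : ecls e false * ecls e true = 1.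
  by rewrite /ecls -(clsM [:: _] [:: _]); apply/cls_eqP/relator_equiv/(rel_inv e false).
by rewrite mul1g.
Qed.

Lemma tree_endpt_subproof v0 eC b :
  tree_edges v0 eC -> tree_verts v0 (tree_endpt_fun eC b).
Proof.
case: eC => e C [/= x xP ->]; case: b.
- exists (x * ecls e false); first by exact: path_classM (path_class_ecls e false).
  apply/seteqP; split=> z /=.
  + move=> [_ [g [[_ [_ [a [-> ->]]] <-]] ->]] /=.
    exists (x * ecls e false), (inc G e true a * g); split=> //.
    by rewrite vclsM -(mulgA x) inc_ecls !mulgA.
  + move=> [_ [g [-> ->]]]; exists (x * ecls e false), g; split=> //.
    exists x => //; exists x, 1; split => //.
    by rewrite gmulf1 vcls1 mulg1.
- exists x => //; apply/seteqP; split=> z /=.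
  + move=> [_ [g [[_ [_ [a [-> ->]]] <-]] ->]] /=.
    exists x, (inc G e false a * g); split=> //.
    by rewrite vclsM mulg1 mulgA.
  + move=> [_ [g [-> ->]]]; exists x, g; split=> //.
    exists x; last by rewrite mulg1.
    by exists x, 1; split => //; rewrite gmulf1 vcls1 mulg1.
Qed.

Definition bass_serre_tree (v0 : vert Y) : graph :=
  @Graph (set_type (tree_verts v0)) (set_type (tree_edges v0))
    (fun e b => exist _ (tree_endpt_fun (sval e) b)
      (mem_set (tree_endpt_subproof b (set_mem (svalP e))))).

End FundamentalGroup.
Arguments path_class {Y} G u v _.
Arguments tree_verts {Y} G v0 _.
Arguments tree_edges {Y} G v0 _.

Record subgroups_over (Y : graph) (G : graph_of_groups Y) (Y' : subgraph Y) :=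
  SubgroupsOver {
    sub_vgroup : forall v : vert Y', subgroup (vgroup G (sval v));
    sub_egroup : forall e : edge Y', subgroup (egroup G (sval e));
    sub_inc : forall (e : edge Y') (b : bool) (a : egroup G (sval e)),
      subgroup_set (sub_egroup e) a ->
      subgroup_set (sub_vgroup (endpt e b)) (inc G (sval e) b a) }.

Section SubgraphOfSubgroups.
Context (Y : graph) (G : graph_of_groups Y) (Y' : subgraph Y).
Context (G' : subgroups_over G Y').

Definition restr_inc (e : edge Y') (b : bool)
    (a : subgroup_type (sub_egroup G' e)) :
    subgroup_type (sub_vgroup G' (endpt e b)) :=
  exist _ (inc G (sval e) b (val a)) (mem_set (sub_inc b (subgroup_memP a))).

Lemma restr_incF e b : {morph @restr_inc e b : x y / x / y}.
Proof. by move=> x y; apply: val_inj; rewrite /= !gmulfF. Qed.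
HB.instance Definition _ e b :=
  isGroupMorphism.Build _ _ (@restr_inc e b) (@restr_incF e b).

Lemma restr_inc_inj e b : injective (@restr_inc e b).
Proof. by move=> x y [/inc_inj h]; apply: val_inj. Qed.

Definition sub_graph_of_groups : graph_of_groups Y' :=
  @GraphOfGroups Y'
    (fun v => subgroup_type (sub_vgroup G' v) : groupType)
    (fun e => subgroup_type (sub_egroup G' e) : groupType)
    (fun e b => @restr_inc e b : UMagmaMorphism.type _ _) restr_inc_inj.

Local Notation sG := sub_graph_of_groups.

Definition letter_incl (l : letter sG) : letter G :=
  match l with
  | inl s => vl (val (projT2 s : subgroup_type (sub_vgroup G' (projT1 s))))
  | inr (e, b) => el G (sval e) b
  end.

Lemma word_equiv_incl (u v : seq (letter sG)) :
  word_equiv u v -> word_equiv (map letter_incl u) (map letter_incl v).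
Proof.
elim=> [_ _ [p q s t st]|w|w1 w2 _|w1 w2 w3 _ h1 _ h2].
- rewrite !map_cat; apply/word_equiv_ctx/relator_equiv.
  case: st => /= [x|x g h|e b|e b a].
  + exact: rel_one.
  + exact: rel_mul.
  + exact: rel_inv.
  + exact: (rel_edge b (val (a : subgroup_type (sub_egroup G' e)))).
- exact: rst_refl.
- exact: rst_sym.
- exact: rst_trans h2.
Qed.

Definition path_group_incl (x : path_group sG) : path_group G :=
  cls (map letter_incl (repr x)).

Lemma path_group_incl_cls w :
  path_group_incl (cls w) = cls (map letter_incl w).
Proof. exact/cls_eqP/word_equiv_incl/repr_cls. Qed.

Lemma path_group_inclM : {morph path_group_incl : x y / x * y}.
Proof.
move=> x y; rewrite -(clsK x) -(clsK y) -clsM !path_group_incl_cls.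
by rewrite map_cat clsM.
Qed.

Lemma path_group_incl_vcls (v : vert Y') (g : vgroup sG v) :
  path_group_incl (vcls g) =
  vcls (val (g : subgroup_type (sub_vgroup G' v))).
Proof. exact: path_group_incl_cls. Qed.

Lemma path_group_incl_ecls (e : edge Y') b :
  path_group_incl (ecls sG e b) = ecls G (sval e) b.
Proof. exact: path_group_incl_cls. Qed.

Lemma path_group_incl1 : path_group_incl 1 = 1.
Proof. exact: path_group_incl_cls [::]. Qed.

Lemma path_class_incl (u v : vert Y') x :
  path_class sG u v x -> path_class G (sval u) (sval v) (path_group_incl x).
Proof.
move=> [w wP ->]; exists (map letter_incl w); last exact: path_group_incl_cls.
elim: w u wP => [|l w IH] u /= => [->//|[<- /IH h]].
by case: l h => [[]|[]].
Qed.

Lemma pi1_incl_subproof (v0 : vert Y') (x : pi1 sG v0) :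
  path_group_incl (sval x) \in mem (subgroup_set (loops G (sval v0))).
Proof. by apply/mem_set/path_class_incl/(subgroup_memP x). Qed.

Definition pi1_incl (v0 : vert Y') (x : pi1 sG v0) : pi1 G (sval v0) :=
  exist _ (path_group_incl (sval x)) (pi1_incl_subproof x).

Lemma pi1_inclM v0 : {morph @pi1_incl v0 : x y / x * y}.
Proof. by move=> x y; apply: val_inj; rewrite /= path_group_inclM. Qed.

Definition tree_vmap_fun (vC : vert Y' * set (path_group sG)) :
    vert Y * set (path_group G) :=
  (sval vC.1, vcoset (sval vC.1) [set path_group_incl x | x in vC.2]).

Definition tree_emap_fun (eC : edge Y' * set (path_group sG)) :
    edge Y * set (path_group G) :=
  (sval eC.1, ecoset (sval eC.1) [set path_group_incl x | x in eC.2]).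

Lemma tree_vmap_subproof v0 vC :
  tree_verts sG v0 vC -> tree_verts G (sval v0) (tree_vmap_fun vC).
Proof.
case: vC => v C [/= x xP ->]; exists (path_group_incl x).
  exact: path_class_incl.
apply/seteqP; split=> z /=.
- move=> [_ [g [[_ [_ [h [-> ->]]] <-] ->]]].
  exists (path_group_incl x).
  exists (val (h : subgroup_type (sub_vgroup G' v)) * g); split=> //.
  by rewrite path_group_inclM path_group_incl_vcls vclsM mulgA.
- move=> [_ [g [-> ->]]]; exists (path_group_incl x), g; split=> //.
  by exists x => //; exists x, 1; split=> //; rewrite vcls1 mulg1.
Qed.

Lemma tree_emap_subproof v0 eC :
  tree_edges sG v0 eC -> tree_edges G (sval v0) (tree_emap_fun eC).
Proof.
case: eC => e C [/= x xP ->]; exists (path_group_incl x).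
  exact: path_class_incl xP.
apply/seteqP; split=> z /=.
- move=> [_ [g [[_ [_ [h [-> ->]]] <-] ->]]].
  exists (path_group_incl x).
  exists (val (h : subgroup_type (sub_egroup G' e)) * g); split=> //.
  by rewrite path_group_inclM path_group_incl_vcls gmulfM vclsM mulgA.
- move=> [_ [g [-> ->]]]; exists (path_group_incl x), g; split=> //.
  by exists x => //; exists x, 1; split=> //; rewrite gmulf1 vcls1 mulg1.
Qed.

Definition tree_vmap v0 (v : vert (bass_serre_tree sG v0)) :
    vert (bass_serre_tree G (sval v0)) :=
  exist _ (tree_vmap_fun (sval v))
    (mem_set (tree_vmap_subproof (set_mem (svalP v)))).

Definition tree_emap v0 (e : edge (bass_serre_tree sG v0)) :
    edge (bass_serre_tree G (sval v0)) :=
  exist _ (tree_emap_fun (sval e))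
    (mem_set (tree_emap_subproof (set_mem (svalP e)))).

Lemma tree_endpt_map v0 (e : edge (bass_serre_tree sG v0)) (b : bool) :
  tree_vmap (endpt e b) = endpt (tree_emap e) b.
Proof.
apply: val_inj; case: e => -[e C] /= eC; rewrite /tree_vmap_fun /tree_endpt_fun /=.
congr pair; have [x xP /= ->] := set_mem eC.
set t := if b then ecls sG e false else 1.
set t' := if b then ecls G (sval e) false else 1.
have tE : path_group_incl t = t'.
  by rewrite /t /t'; case: (b); [exact: path_group_incl_ecls|exact: path_group_incl1].
have incE (a : egroup G (sval e)) :
    vcls (inc G (sval e) false a) * t' = t' * vcls (inc G (sval e) b a).
  by rewrite /t'; case: (b); [exact: inc_ecls|rewrite mul1g mulg1].
apply/seteqP; split=> z /=.
- move=> [_ [g [[_ [_ [h [[_ [_ [a [-> ->]]] <-] ->]]] <-] ->]]].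
  exists (path_group_incl (x * vcls (inc sG e false a)) * t').
  exists (val (h : subgroup_type (sub_vgroup G' (endpt e b))) * g).
  split; last first.
    by rewrite 2!path_group_inclM path_group_incl_vcls tE vclsM !mulgA.
  exists (path_group_incl (x * vcls (inc sG e false a))) => //.
  exists (path_group_incl (x * vcls (inc sG e false a))), 1.
  split; last by rewrite gmulf1 vcls1 mulg1.
  by exists (x * vcls (inc sG e false a)) => //; exists x, a.
- move=> [_ [g [[_ [_ [a [[y yP <-] ->]]] <-] ->]]].
  exists (path_group_incl (y * t)), (inc G (sval e) b a * g); split; last first.
    by rewrite vclsM path_group_inclM tE -(mulgA (path_group_incl y)) incE !mulgA.
  exists (y * t) => //; exists (y * t), 1; split; last by rewrite vcls1 mulg1.
  by exists y.
Qed.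

Definition tree_incl (v0 : vert Y') :
    graph_morphism (bass_serre_tree sG v0) (bass_serre_tree G (sval v0)) :=
  GraphMorphism (@tree_endpt_map v0).

(* Whether this holds does not depend on the base vertex [v0]. *)
Definition subgraph_of_subgroups (v0 : vert Y') : Prop :=
  connected Y' /\ injective_graph_morphism (tree_incl v0).

End SubgraphOfSubgroups.

(* Main.v *)
(** Since the edge groups of the two graphs of groups agree, [pi1 G] is a star
    amalgam: the centre is [H = pi1 G'], the leaves are the vertex groups [G_v],
    amalgamated over [G'_v].  Weak malnormality of [H] passes to [G'_v] in
    [G_v]; as [G'_v] is also quasiconvex in the hyperbolic group [G_v], nearest
    point projection [G_v -> G'_v] is coarsely Lipschitz and sends every coset
    [g G'_v] other than [G'_v] to a uniformly bounded set.  Hence sending an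
    element with normal form [h g_1 h_1 g_2 ...] to [h * proj (g_1)] is a
    coarsely Lipschitz retraction of [pi1 G] onto [H].  In a hyperbolic group a
    coarse Lipschitz retract is quasiconvex, by exponential divergence. *)
Require Import Defs.
From mathcomp Require Import all_boot all_order all_algebra.
From mathcomp Require Import boolp classical_sets functions cardinality.
From mathcomp Require Import zify lra.

Set Implicit Arguments.
Unset Strict Implicit.
Unset Printing Implicit Defensive.

Import Order.TTheory GRing.Theory Num.Theory.
Local Open Scope classical_set_scope.
Local Open Scope card_scope.

(** * Quasiconvexity in four-point hyperbolic spaces *)

(** The amalgam is never built as a group. The argument takes place in Serre's group [path_group G],
    which contains edge letters and all vertex groups at once. There the centre is the image of the
    path group of the subgraph of subgroups, and chosen paths to the base vertex bring the result
    back to loops. Two facts support this: vertex groups embed in Serre's group, and the centre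
    meets each of them exactly in the given subgroup; the second is where injectivity on Bass--Serre
    trees enters. Normal forms are handled by van der Waerden's method: letters act on them. A
    normal form knows g_1 only up to its coset, so the projection must be exactly constant on
    nontrivial cosets; nearest points are only coarsely so, and are therefore taken from coset
    representatives. The coarse Lipschitz property is phrased as finiteness, for each s, of the set
    of values rho(x)^-1 rho(xs), a form that passes through homomorphisms without a choice of
    generators. *)

Lemma linear_le_expn (b : nat) :
  exists k0, forall k, k0 <= k -> b * k.+1 <= 2 ^ k.
Proof.
exists b.*2.+2 => k /subnKC <-; elim: (k - _) => [|i IH].
  rewrite addn0 !expnS -mul2n expnM.
  have := ltn_expl b (isT : 1 < 2).
  have -> : (2 ^ 2) ^ b = 2 ^ b * 2 ^ b by rewrite -expnM mulnC expnM expnS expn1.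
  move: (2 ^ b) => c; nia.
by rewrite addnS expnS; nia.
Qed.

Section MetricGeometry.
Context (T : Type) (d : T -> T -> nat).

Definition four_point (k : nat) : Prop := forall w x y z,
  d x z + d y w <= maxn (d x y + d z w) (d y z + d x w) + k.

Lemma gromov_hyperbolic_four_point :
  gromov_hyperbolic d -> exists k, four_point k.
Proof.
move=> [delta hyp]; exists (Num.bound (2%:R * delta)%R) => w x y z.
have := archi_boundP (normr_ge0 (2%:R * delta)%R).
have := hyp w x y z; rewrite /gromov_product /Num.bound normr_id.
set k := (Num.trunc _).+1 => h1 h2; have := le_lt_trans (ler_norm _) h2.
rewrite -(ler_nat rat) !natrD; move: h1; rewrite minEle maxnE.
have [le|lt] := leqP (d x y + d z w) (d y z + d x w).
  rewrite subnKC // natrD; case: ifP => _; last lra.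
  by move: le; rewrite -(ler_nat rat) !natrD; lra.
rewrite (eqP (ltnW lt : _ - _ == 0)) addn0 natrD; case: ifP => _; first lra.
by move: (ltnW lt); rewrite -(ler_nat rat) !natrD; lra.
Qed.

Hypothesis dxx : forall x, d x x = 0.
Hypothesis dC : forall x y, d x y = d y x.
Hypothesis d_triangle : forall x y z, d x z <= d x y + d y z.
Hypothesis d_geodesic : forall x y,
  exists p, [/\ geodesic d (d x y) p, p 0 = x & p (d x y) = y].

(** A coarse path in A with jumps at most L, which is all that remains of a geodesic after a coarse
    Lipschitz map. *)
Definition joined (A : set T) (L n : nat) (a b : T) : Prop :=
  exists u : nat -> T, [/\ u 0 = a, u n = b, forall i, i <= n -> A (u i) &
    forall i, i < n -> d (u i) (u i.+1) <= L].

Lemma joined_cat (A : set T) L m n a b c :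
  joined A L m a b -> joined A L n b c -> joined A L (m + n) a c.
Proof.
move=> [u [u0 um Au Lu]] [w [w0 wn Aw Lw]].
exists (fun i => if i <= m then u i else w (i - m)); split=> //.
- case: ifP => [le|_]; last by rewrite addKn.
  have n0 : n = 0 by lia.
  by move: wn; rewrite n0 addn0 w0 um.
- move=> i le; case: ifP => [|/negbT]; first exact: Au.
  by rewrite -ltnNge => lt; apply: Aw; lia.
- move=> i lt; have [lt1|le1] := ltnP i m.
    by rewrite (ltnW lt1); apply: Lu.
  have [->|ne] := eqVneq i m.
    by rewrite leqnn um subSn // subnn -w0; apply: Lw; lia.
  rewrite ifF ?subSn //; last by apply/negbTE; lia.
  by apply: Lw; lia.
Qed.

Lemma joined_sub (A B : set T) L L' n a b :
  A `<=` B -> L <= L' -> joined A L n a b -> joined B L' n a b.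
Proof.
move=> AB LL' [u [u0 un Au Lu]]; exists u; split=> // i lt; first exact/AB/Au.
exact: leq_trans (Lu i lt) LL'.
Qed.

Lemma joined_rev (A : set T) L n a b : joined A L n a b -> joined A L n b a.
Proof.
move=> [u [u0 un Au Lu]]; exists (fun i => u (n - i)).
rewrite subn0 subnn; split=> // i lt; first by apply: Au; rewrite leq_subr.
have -> : n - i = (n - i.+1).+1 by lia.
by rewrite dC; apply: Lu; lia.
Qed.

Lemma joined_geodesic (A : set T) a b :
  (forall w, d a w + d w b = d a b -> A w) -> joined A 1 (d a b) a b.
Proof.
move=> Ab; have [p [pP p0 pn]] := d_geodesic a b; exists p; split=> //.
  move=> i le; apply: Ab.
  have := pP 0 i le; have := pP i (d a b); rewrite p0 pn le leqnn => -> // ->.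
  by rewrite subn0 subnKC.
by move=> i lt; rewrite pP ?subSnn ?leqnSn.
Qed.

(* Exponential divergence: avoiding the ball of radius [D] about [x] forces a
   chain to have length exponential in [D]. *)
Lemma joined_far (delta : nat) (hyp : four_point delta) (x : T) (D L k : nat) :
  forall n a b, n <= 2 ^ k -> joined [set w | D <= d w x] L n a b ->
  d a b + D.*2 <= d a x + d b x + L + k * delta.
Proof.
elim: k => [|k IH] n a b.
  rewrite expn0 => le [u [u0 un Au Lu]]; have := Au 0; have := Au n.
  rewrite /= u0 un leqnn => /(_ isT) bx /(_ isT) ax.
  case: n le un Lu {Au} => [|[|//]] _ un Lu.
    by move: bx; rewrite -un u0 dxx; lia.
  by have := Lu 0 isT; rewrite u0 un; lia.
rewrite expnS => le [u [u0 un Au Lu]].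
set m := n./2; have mn : m <= n by rewrite /m; lia.
have h1 : d a (u m) + D.*2 <= d a x + d (u m) x + L + k * delta.
  apply: (IH m); first by rewrite /m; lia.
  by exists u; split=> // i ?; [apply: Au|apply: Lu]; lia.
have h2 : d (u m) b + D.*2 <= d (u m) x + d b x + L + k * delta.
  apply: (IH (n - m)); first by rewrite /m; lia.
  exists (fun i => u (m + i)); split; rewrite ?addn0 ?subnKC //.
    by move=> i ?; apply: Au; lia.
  by move=> i ?; rewrite addnS; apply: Lu; lia.
(* The distance from the midpoint to x cancels, so each halving of the chain costs a single
   delta. *)
have := hyp x a (u m) b; lia.
Qed.

Definition closest (A : set T) (x p : T) : Prop :=
  A p /\ forall a, A a -> d x p <= d x a.

Lemma closest_exists (A : set T) (x : T) : A !=set0 -> exists p, closest A x p.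
Proof.
move=> [a Aa]; pose P n := `[< exists2 b, A b & d x b = n >].
have exP : exists n, P n by exists (d x a); apply/asboolP; exists a.
have [n /asboolP[p Ap xp] min] := ex_minnP exP.
by exists p; split=> // b Ab; rewrite xp; apply: min; apply/asboolP; exists b.
Qed.

(** Let x be the point of the geodesic farthest from A, at distance D. Moving 2D along the geodesic
    to either side, descending to A and crossing inside A avoids the ball of radius D about x in a
    number of steps linear in D, whereas [joined_far] requires exponentially many once D is
    large. *)
Lemma quasiconvex_joined (delta L : nat) (A : set T) :
  four_point delta ->
  (forall a b, A a -> A b -> exists2 n, n <= L * d a b & joined A L n a b) ->
  quasiconvex_dist d A.
Proof.
(* The detour has two descents of at most D steps and a crossing between points of A at distance at
   most D + 4D + D. *)
move=> hyp Ajoin; have [k0 k0P] := linear_le_expn ((6 * L + 2) * delta.+1).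
(* D above the first term exceeds every jump of the chain; D above the second makes [D %/ delta.+1]
   at least [k0]. *)
pose K := maxn L.+1 (k0 * delta.+1); exists K => n p pP Ap0 Apn.
have A0 : A !=set0 by exists (p 0).
have [f fP] := choice (fun x => @closest_exists A x A0).
suff bound i : i <= n -> d (p i) (f (p i)) <= K.
  by move=> i le; exists (f (p i)); [case: (fP (p i))|exact: bound].
pose g (i : 'I_n.+1) := d (p i) (f (p i)).
have [/= j _ jmax] := arg_maxnP g (isT : xpredT (ord0 : 'I_n.+1)).
have {}jmax l : l <= n -> d (p l) (f (p l)) <= g j.
  by rewrite -ltnS => lt; apply: (jmax (Ordinal lt) isT).
move=> le; apply: leq_trans (jmax i le) _; clear i le.
rewrite leqNgt; apply/negP => big.
move: big jmax; rewrite /g; have : j <= n by rewrite -ltnS.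
case: j => /= j _; set x := p j; set D := d x (f x) => jn big jmax.
have farA a : A a -> D <= d a x.
  by move=> Aa; rewrite dC; case: (fP x) => _; apply.
have end_ (l : nat) : l <= n ->
    (l = 0 \/ l = n) \/ D.*2 <= d (p l) x ->
    [/\ joined [set w | D <= d w x] (maxn 1 L) (d (p l) (f (p l))) (p l) (f (p l)),
        d (p l) (f (p l)) <= D & A (f (p l))].
  move=> ln hl; have ple := jmax l ln; have [Af fmin] := fP (p l); split=> //.
  apply: (@joined_sub [set w | D <= d w x] _ 1) => //; first lia.
  apply: joined_geodesic => w wP /=.
  (* A descent of length at most D from a point 2D away stays outside the ball. If the geodesic ends
     earlier, its end lies in A and the descent is constant. *)
  case: hl => [hl|?]; last by have := d_triangle (p l) w x; lia.
  have Apl : A (p l) by case: hl => ->.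
  have := fmin _ Apl; rewrite dxx leqn0 => /eqP d0.
  have := farA _ Apl; have := d_triangle (p l) w x; lia.
pose l1 := j - D.*2; pose l2 := minn n (j + D.*2).
have d1 : d (p l1) x = j - l1 by rewrite /x pP // /l1; lia.
have d2 : d x (p l2) = l2 - j by rewrite /x pP // /l2; lia.
have d12 : d (p l1) (p l2) = l2 - l1 by rewrite pP // /l1 /l2; lia.
have [||J1 D1 A1] := end_ l1; [by rewrite /l1; lia|by rewrite d1 /l1; lia|].
have [||J2 D2 A2] := end_ l2; [by rewrite /l2; lia|by rewrite dC d2 /l2; lia|].
have [m mle Jm] := Ajoin _ _ A1 A2.
have mD : m <= 6 * L * D.
  apply: leq_trans mle _; rewrite (mulnC 6) -mulnA leq_mul2l; apply/orP; right.
  have := d_triangle (f (p l1)) (p l1) (f (p l2)).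
  have := d_triangle (p l1) (p l2) (f (p l2)).
  by rewrite (dC _ (p l1)) d12; move: D1 D2; rewrite /l1 /l2; lia.
have J : joined [set w | D <= d w x] (maxn 1 L)
    (d (p l1) (f (p l1)) + (m + d (p l2) (f (p l2)))) (p l1) (p l2).
  apply: joined_cat J1 _; apply: joined_cat _ (joined_rev J2).
  by apply: joined_sub Jm => //; lia.
pose k := D %/ delta.+1.
have k0k : k0 <= k by rewrite /k leq_divRL //; move: big; rewrite /K; lia.
have kD : k * delta <= D.
  by apply: leq_trans (leq_trunc_div D delta.+1); rewrite leq_mul2l leqnSn orbT.
have Dk : D <= k.+1 * delta.+1 by rewrite ltnW // -ltn_divLR.
have mk : d (p l1) (f (p l1)) + (m + d (p l2) (f (p l2))) <= 2 ^ k.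
  apply: leq_trans (k0P _ k0k).
  apply: (@leq_trans ((6 * L + 2) * D)); first by rewrite mulnDl; lia.
  by rewrite -mulnA leq_mul2l (mulnC delta.+1) Dk orbT.
(* As x lies on the geodesic between the two ends, this reads 2D <= maxn 1 L + k delta, while the
   right side is below 2D. *)
have := joined_far hyp mk J; rewrite d12 d1 dC d2.
have : maxn 1 L < D by move: big; rewrite /K; lia.
have : l1 <= j <= l2 by rewrite /l1 /l2; lia.
by clearbody l1 l2; move: (k * delta) kD (maxn 1 L) => kd kD M; lia.
Qed.

Definition quasiconvex_const (K : nat) (A : set T) : Prop :=
  forall (n : nat) (p : nat -> T), geodesic d n p -> A (p 0) -> A (p n) ->
  forall i, i <= n -> exists2 a, A a & d (p i) a <= K.

(** * Nearest points in a quasiconvex set *)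

Section Projection.
Context (delta K : nat) (A : set T).
Hypothesis hyp : four_point delta.
Hypothesis qcA : quasiconvex_const K A.
Let c := K.*2 + delta.*2 + 1.

(** Otherwise the point at distance K + delta + 1 from p on a geodesic from p to a would, by the
    four-point condition, be nearer to x than p by more than K, and A passes within K of it. If a is
    closer to p than that, the bound is immediate. *)
Lemma closest_triangle x p a :
  closest A x p -> A a -> d x p + d p a <= d x a + c.
Proof.
move=> [Ap min] Aa; have [u [uP u0 un]] := d_geodesic p a.
have [t tE] : exists t, t = minn (K + delta).+1 (d p a) by eexists.
have tn : t <= d p a by lia.
have [||b Ab ub] := qcA uP _ _ tn; rewrite ?u0 ?un //.
have := min b Ab; have := d_triangle x (u t) b.
have := uP 0 t; rewrite u0 tn /= => /(_ isT).
have := uP t (d p a); rewrite un tn leqnn /= => /(_ isT).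
have := hyp p x a (u t); rewrite (dC a p) (dC (u t) p) (dC a (u t)) /c.
by have := min a Aa; lia.
Qed.

(** Adding [closest_triangle] for x and for y, after two triangle inequalities, cancels the
    distances to p and q. *)
Lemma closest_lipschitz x y p q :
  closest A x p -> closest A y q -> d p q <= d x y + c.
Proof.
move=> xp yq; have := closest_triangle xp yq.1; have := closest_triangle yq xp.1.
have := d_triangle x y q; have := d_triangle y x p.
by rewrite (dC y x) (dC q p); lia.
Qed.

(** Far apart projections make x, p, q, y almost aligned, so the point at distance d x p from x on a
    geodesic from x to y is within 2c + 2 delta of p, and B passes within K of that point. *)
Lemma closest_near (B : set T) x y p q : quasiconvex_const K B -> B x -> B y ->
  closest A x p -> closest A y q -> c.*2 + delta < d p q ->
  exists2 b, B b & d p b <= c.*2 + delta.*2 + K.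
Proof.
move=> qcB Bx By xp yq far.
have h1 := closest_triangle xp yq.1; have h2 := closest_triangle yq xp.1.
have [u [uP u0 un]] := d_geodesic x y.
have h3 := hyp p x y q; rewrite (dC q p) in h2 h3.
have xy : d x p + d p q + d y q <= d x y + c.*2 + delta by lia.
have tn : d x p <= d x y by lia.
have [||b Bb ub] := qcB _ _ uP _ _ _ tn; rewrite ?u0 ?un //.
exists b => //; apply: leq_trans (d_triangle p (u (d x p)) b) _.
have := uP 0 (d x p); rewrite u0 tn /= => /(_ isT).
have := uP (d x p) (d x y); rewrite un tn leqnn /= => /(_ isT).
have := hyp y (u (d x p)) x p; have := d_triangle p q y.
rewrite (dC q y) (dC p y) (dC p (u _)) (dC (u _) x) => *.
lia.
Qed.

End Projection.

End MetricGeometry.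

(** * Word metrics *)

Section WordLength.
Local Open Scope group_scope.
Context (G : groupType) (S : set G).
Hypothesis Sgen : finite_generating S.

Lemma has_word1 : has_word S 1 0.
Proof. by exists [::]; rewrite big_nil. Qed.

Lemma has_wordM x y m n :
  has_word S x m -> has_word S y n -> has_word S (x * y) (m + n)%N.
Proof.
move=> [u [uS um <-]] [w [wS wn <-]]; exists (u ++ w).
by rewrite big_cat size_cat um wn; split=> // z; rewrite mem_cat => /orP[/uS|/wS].
Qed.

Lemma has_wordV x n : has_word S x n -> has_word S x^-1 n.
Proof.
move=> [u [uS <- <-]]; exists (rev [seq z^-1 | z <- u]); split.
- move=> z; rewrite mem_rev => /mapP[t /uS tS ->].
  by rewrite invgK; case: tS; [right|left].
- by rewrite size_rev size_map.
- rewrite -map_rev big_map; elim: u {uS} => [|a u IH].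
    by rewrite !big_nil invg1.
  by rewrite rev_cons -cats1 big_cat big_seq1 big_cons invgM IH.
Qed.

Lemma word_lengthP g :
  has_word S g (word_length S g) /\
  forall n, has_word S g n -> (word_length S g <= n)%N.
Proof.
rewrite /word_length; case: xgetP => [n -> //|none].
have [_ /(_ g)[n0 gn0]] := Sgen.
have exP : exists n, `[< has_word S g n >] by exists n0; apply/asboolP.
have [n /asboolP gn min] := ex_minnP exP.
by case: (none n); split=> // m gm; apply/min/asboolP.
Qed.

Lemma has_word_length g : has_word S g (word_length S g).
Proof. by case: (word_lengthP g). Qed.

Lemma word_length_min g n : has_word S g n -> (word_length S g <= n)%N.
Proof. by case: (word_lengthP g) => _; apply. Qed.

Lemma word_length1 : word_length S 1 = 0%N.
Proof. by apply/eqP; rewrite -leqn0; apply/word_length_min/has_word1. Qed.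

Lemma word_lengthM x y :
  (word_length S (x * y) <= word_length S x + word_length S y)%N.
Proof.
exact/word_length_min/has_wordM/has_word_length/has_word_length.
Qed.

Lemma word_lengthV x : word_length S x^-1 = word_length S x.
Proof.
apply/eqP; rewrite eqn_leq; apply/andP; split; last rewrite -{1}(invgK x);
  exact/word_length_min/has_wordV/has_word_length.
Qed.

Lemma finite_has_word n : finite_set [set g | has_word S g n].
Proof.
have [fS _] := Sgen.
elim: n => [|n IH].
  apply: sub_finite_set (finite_set1 1) => g [w [_ /size0nil -> <-]].
  by rewrite big_nil.
have fS' : finite_set (S `|` [set z^-1 | z in S]).
  by rewrite finite_setU; split=> //; apply: finite_image.
apply: sub_finite_set (finite_image2 (fun x y => x * y) fS' IH).
move=> _ [[|a w] [wS // [wn] <-]]; rewrite big_cons; exists a.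
  have [Sa|Sa] := wS a (mem_head a w); [by left|right].
  by exists a^-1; rewrite ?invgK.
exists (\prod_(x <- w) x) => //; exists w; split=> // x xw.
by apply: wS; rewrite inE xw orbT.
Qed.

Lemma finite_ball n : finite_set [set g | (word_length S g <= n)%N].
Proof.
have -> : [set g | (word_length S g <= n)%N]
    = \bigcup_(i in `I_n.+1) [set g | word_length S g = i].
  apply/seteqP; split=> g /=; first by move=> le; exists (word_length S g).
  by move=> [i /= lt ->]; rewrite -ltnS.
apply: bigcup_finite => [|i _]; first exact: finite_II.
by apply: sub_finite_set (finite_has_word i) => g /= <-; apply: has_word_length.
Qed.

Local Notation d := (word_dist S).

Lemma word_dist_left g x y : d (g * x) (g * y) = d x y.
Proof. by rewrite /word_dist invgM mulgA mulgVK. Qed.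

Lemma word_distxx x : d x x = 0%N.
Proof. by rewrite /word_dist mulVg word_length1. Qed.

Lemma word_distC x y : d x y = d y x.
Proof. by rewrite /word_dist -word_lengthV invgM invgK. Qed.

Lemma word_dist_triangle x y z : (d x z <= d x y + d y z)%N.
Proof.
by rewrite /word_dist -(divgKA y^-1 x^-1 z) invgK word_lengthM.
Qed.

Lemma word_geodesic x y :
  exists p, [/\ geodesic d (d x y) p, p 0%N = x & p (d x y) = y].
Proof.
have [w [wS wn wE]] := has_word_length (x^-1 * y).
pose p i := x * \prod_(z <- take i w) z.
have step i j : (i <= j)%N -> (d (p i) (p j) <= j - i)%N.
  move=> ij; rewrite word_dist_left /word_dist.
  have -> : take j w = take i w ++ take (j - i) (drop i w).
    by rewrite -takeD subnKC.
  rewrite big_cat mulKg; apply: leq_trans (_ : size (take (j - i) (drop i w)) <= _)%N.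
    apply: word_length_min; exists (take (j - i) (drop i w)); split=> //.
    by move=> z /mem_take /mem_drop /wS.
  by rewrite size_take; case: ifP => // /negbT; rewrite -leqNgt.
have p0 : p 0%N = x by rewrite /p take0 big_nil mulg1.
have pn : p (d x y) = y by rewrite /p /word_dist -wn take_size wE mulVKg.
exists p; split=> // i j /andP[ij jn]; apply/eqP; rewrite eqn_leq step //=.
have := step 0%N i isT; have := step j _ jn.
have := word_dist_triangle (p 0%N) (p i) (p (d x y)).
have := word_dist_triangle (p i) (p j) (p (d x y)).
have -> : d (p 0%N) (p (d x y)) = d x y by rewrite pn p0.
by rewrite subn0; lia.
Qed.

Lemma closest_left (C : set G) h x p :
  (forall c, C c -> C (h * c)) -> (forall c, C c -> C (h^-1 * c)) ->
  closest d C x p -> closest d C (h * x) (h * p).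
Proof.
move=> Ch ChV [Cp min]; split=> [|a /ChV/min]; first exact: Ch.
by rewrite -(word_dist_left h) -(word_dist_left h x) mulVKg.
Qed.

End WordLength.

Lemma word_length_change (G : groupType) (S T : set G) :
  finite_generating S -> finite_generating T ->
  exists L, forall g, (word_length T g <= L * word_length S g)%N.
Proof.
move=> Sgen Tgen; have [fS _] := Sgen.
have [s sE] := (finite_seqP _).1 fS.
pose L := (\max_(x <- s) word_length T x)%N; exists L => g.
have [w [wS <- <-]] := has_word_length Sgen g.
elim: w wS => [|a w IH] wS; first by rewrite big_nil word_length1.
rewrite big_cons mulnS; apply: leq_trans (word_lengthM Tgen _ _) (leq_add _ _).
  have [Sa|Sa] := wS a (mem_head a w).
    by move: Sa; rewrite sE /L => as_; apply: leq_bigmax_seq.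
  by rewrite -word_lengthV //; move: Sa; rewrite sE /L => as_; apply: leq_bigmax_seq.
by apply: IH => x xw; apply: wS; rewrite inE xw orbT.
Qed.

(** Points of A close to a T-geodesic form a chain of the kind [quasiconvex_joined] asks for in the
    metric of S. *)
Lemma quasiconvex_change (G : groupType) (S : set G) (A : set G) (delta : nat) :
  finite_generating S -> four_point (word_dist S) delta ->
  quasiconvex A -> quasiconvex_dist (word_dist S) A.
Proof.
move=> Sgen hyp [T Tgen [K qc]].
have [L1 L1P] := word_length_change Sgen Tgen.
have [L2 L2P] := word_length_change Tgen Sgen.
(* [L1] controls the number of steps; consecutive points of the chain are within K + 1 + K for T,
   and [L2] converts this to S. *)
pose L := (maxn L1 (L2 * (2 * K + 1)))%N.
apply: (@quasiconvex_joined _ _ (word_distxx Sgen) (word_distC Sgen)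
  (word_dist_triangle Sgen) (word_geodesic Sgen) delta L) => // a b Aa Ab.
have [p [pP p0 pn]] := word_geodesic Tgen a b.
set n := word_dist T a b in pP pn.
have near i : exists c, (i <= n)%N -> A c /\ (word_dist T (p i) c <= K)%N.
  have [le|gt] := leqP i n; last by exists a; lia.
  have [|//|c Ac cK] := qc n p pP _ _ i le; rewrite ?p0 ?pn //.
  by exists c.
have [c cP] := choice near.
exists n; first by apply: leq_trans (L1P _) _; rewrite leq_mul2r leq_maxl orbT.
exists (fun i => if i == 0%N then a else if i == n then b else c i).
split=> //; first by rewrite eqxx; case: eqP => // n0; rewrite -p0 -pn n0.
- move=> i le; case: eqP => // _; case: eqP => // _.
  by case: (cP i le).
- move=> i lt.
  have cP' j : (j <= n)%N -> (word_dist T (p j)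
      (if j == 0%N then a else if j == n then b else c j) <= K)%N.
    move=> le; case: eqP => [->|_]; first by rewrite p0 word_distxx.
    case: eqP => [->|_]; first by rewrite pn word_distxx.
    by case: (cP j le).
  apply: leq_trans (leq_trans (L2P _) _) (leq_maxr _ _).
  rewrite leq_mul2l; apply/orP; right.
  have := cP' i (ltnW lt); have := cP' _ lt; rewrite -/(word_dist T _ _) /=.
  have : word_dist T (p i) (p i.+1) = 1%N by rewrite pP ?leqnSn ?subSnn.
  move: (if i == 0%N then _ else _) (if i.+1 == n then _ else _) => x y.
  have := word_dist_triangle Tgen x (p i) y.
  have := word_dist_triangle Tgen (p i) (p i.+1) y.
  by rewrite (word_distC Tgen x (p i)); lia.
Qed.

(** The image under r of a geodesic between points of A is a chain in A with the same ends;
    finiteness, applied to the s of length at most 1, bounds its jumps. *)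
Lemma quasiconvex_of_retraction (G : groupType) (A : set G) (r : G -> G) :
  hyperbolic_group G ->
  (forall g, A (r g)) -> (forall a, A a -> r a = a) ->
  (forall s, finite_set (range (fun g => (r g)^-1 * r (g * s))%g)) ->
  quasiconvex A.
Proof.
move=> [S Sgen /gromov_hyperbolic_four_point[delta hyp]] Ar rA rfin.
exists S => //.
have [L LP] : exists L, forall g s, (word_length S s <= 1)%N ->
    (word_dist S (r g) (r (g * s)%g) <= L)%N.
  have : finite_set (\bigcup_(s in [set s | (word_length S s <= 1)%N])
      range (fun g => (r g)^-1 * r (g * s))%g).
    by apply: bigcup_finite => // ; apply: finite_ball.
  move=> /finite_seqP[u uE]; exists (\max_(x <- u) word_length S x)%N => g s s1.
  apply: leq_bigmax_seq => //.
  suff : [set` u] ((r g)^-1 * r (g * s))%g by [].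
  by rewrite -uE; exists s => //; exists g.
apply: (@quasiconvex_joined _ _ (word_distxx Sgen) (word_distC Sgen)
  (word_dist_triangle Sgen) (word_geodesic Sgen) delta L.+1) => // a b Aa Ab.
have [p [pP p0 pn]] := word_geodesic Sgen a b.
exists (word_dist S a b); first by rewrite leq_pmull.
exists (r \o p); split=> [||i _|i lt] /=; rewrite ?p0 ?pn; [exact: rA|exact: rA|exact: Ar|].
have -> : p i.+1 = (p i * ((p i)^-1 * p i.+1))%g by rewrite mulVKg.
apply: leqW; apply: LP; rewrite -/(word_dist S _ _) pP ?leqnSn //.
by rewrite subSnn.
Qed.

(** * Projection to a quasiconvex weakly malnormal subgroup *)

Section Subgroups.
Local Open Scope group_scope.
Context (G : groupType) (H : subgroup G).
Local Notation C := (subgroup_set H).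

Lemma subgroup1 : C 1.
Proof. by have [/set_mem] := subgroup_closed H. Qed.

Lemma subgroupV x : C x -> C x^-1.
Proof.
move=> /mem_set Cx; apply: set_mem.
exact: (group_closedV (subgroup_closed H)).
Qed.

Lemma subgroupM x y : C x -> C y -> C (x * y).
Proof.
move=> /mem_set Cx /mem_set Cy; apply: set_mem.
exact: (group_closedM (subgroup_closed H)).
Qed.

Lemma subgroupVr x : C x^-1 -> C x.
Proof. by move=> /subgroupV; rewrite invgK. Qed.

Lemma subgroupMl x y : C x -> C (x * y) -> C y.
Proof. by move=> /subgroupV Cx Cxy; rewrite -(mulKg x y); apply: subgroupM. Qed.

Lemma subgroupMr x y : C y -> C (x * y) -> C x.
Proof. by move=> /subgroupV Cy Cxy; rewrite -(mulgK y x); apply: subgroupM. Qed.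

(** Representing the subgroup itself by 1 is what later lets a removable entry of a normal form be
    detected as 1. *)
Lemma left_coset_rep : exists rep : G -> G,
  [/\ forall g, C (g^-1 * rep g), forall g c, C c -> rep (g * c) = rep g &
      forall c, C c -> rep c = 1].
Proof.
pose coset g := [set h | C (g^-1 * h)].
pose rep g := if `[< C g >] then 1 else xget 1 (coset g).
have repV g : C g -> rep g = 1 by move=> Cg; rewrite /rep asboolT.
exists rep; split=> // [g|g c Cc].
  rewrite /rep; case: asboolP => [Cg|_]; first by rewrite mulg1; apply: subgroupV.
  by case: xgetP => [x _ //|/(_ g)[]]; rewrite /coset /= mulVg; apply: subgroup1.
have [Cg|nCg] := pselect (C g); first by rewrite !repV //; apply: subgroupM.
have nCgc : ~ C (g * c) by move=> /(subgroupMr Cc).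
rewrite /rep !asboolF //; congr (xget 1); apply/seteqP; split=> h; rewrite /coset /=.
  by rewrite invgM -mulgA => /(subgroupMl (subgroupV Cc)).
by move=> Ch; rewrite invgM -mulgA; apply: subgroupM => //; apply: subgroupV.
Qed.

End Subgroups.

(** * Shadows of cosets on a quasiconvex subgroup *)

Section CosetProjection.
Local Open Scope group_scope.
Context (G : groupType) (H : subgroup G) (S : set G) (delta K : nat).
Local Notation C := (subgroup_set H).
Hypothesis Sgen : finite_generating S.
Local Notation d := (word_dist S).
Hypothesis hyp : four_point d delta.
Hypothesis qcC : quasiconvex_const d K C.

Let c := (K.*2 + delta.*2 + 1)%N.
Let far := (c.*2 + delta)%N.
Let R := (c.*2 + delta.*2 + K)%N.

Definition coset_shadow (g : G) : set G :=
  [set p | exists2 a, C a & closest d C (g * a) p].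

Lemma coset_shadow_near g p q : coset_shadow g p -> coset_shadow g q ->
  (far < d p q)%N -> exists2 a, C a & (d p (g * a) <= R)%N.
Proof.
move=> [a Ca pP] [b Cb qP] lt.
have qcg : quasiconvex_const d K [set g * x | x in C].
  move=> n u uP [x Cx x0] [y Cy yn] i le.
  have [|||z Cz uz] := qcC (n := n) (p := fun i => g^-1 * u i) _ _ _ le.
  - by move=> k l kl; rewrite word_dist_left uP.
  - by rewrite -x0 mulKg.
  - by rewrite -yn mulKg.
  exists (g * z); first by exists z.
  by rewrite -(word_dist_left S g^-1) mulKg.
have Ba : [set g * x | x in C] (g * a) by exists a.
have Bb : [set g * x | x in C] (g * b) by exists b.
have [_ [x Cx <-] px] := closest_near (word_distC Sgen) (word_dist_triangle Sgen)
  (word_geodesic Sgen) hyp qcC qcg Ba Bb pP qP lt.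
by exists x.
Qed.

Lemma coset_shadow_left g h p :
  C h -> coset_shadow g p -> coset_shadow (h * g) (h * p).
Proof.
move=> Ch [a Ca ap]; exists a => //; rewrite -mulgA; apply: closest_left => //.
  by move=> x; apply: subgroupM.
by move=> x; apply/subgroupM/subgroupV.
Qed.

Lemma coset_shadow_right g h p :
  C h -> coset_shadow g p -> coset_shadow (g * h) p.
Proof.
move=> Ch [a Ca ap]; exists (h^-1 * a); last by rewrite -mulgA mulVKg.
by apply: subgroupM => //; apply: subgroupV.
Qed.

Hypothesis malC : weakly_malnormal C.

(** If two shadow points are more than twice [far] apart, every shadow point is far from one of
    them, hence within R of f C. The shadow then lies in finitely many sets C \cap f C r with r of
    length at most R, and dividing such a set on the right by one of its elements lands in C \cap f
    C f^-1, which is finite. *)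
Lemma coset_shadow_bounded1 f : ~ C f ->
  exists k, forall p q, coset_shadow f p -> coset_shadow f q -> (d p q <= k)%N.
Proof.
move=> nCf; have [bd|nbd] := pselect (forall p q,
    coset_shadow f p -> coset_shadow f q -> (d p q <= far.*2)%N).
  by exists far.*2.
have [p0 [q0 [fp0 fq0 lt0]]] : exists p0 q0,
    [/\ coset_shadow f p0, coset_shadow f q0 & (far.*2 < d p0 q0)%N].
  apply: contrapT => no; apply: nbd => p q fp fq; rewrite leqNgt.
  by apply/negP => lt; apply: no; exists p, q.
have near p : coset_shadow f p -> exists2 a, C a & (d p (f * a) <= R)%N.
  move=> fp; have [le|lt] := leqP (d p p0) far; last exact: coset_shadow_near lt.
  apply: coset_shadow_near fp fq0 _.
  by have := word_dist_triangle Sgen p0 p q0; rewrite (word_distC Sgen p0 p); lia.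
have fin : finite_set (coset_shadow f).
  pose E r := [set p | C p /\ exists2 a, C a & p = f * a * r].
  apply: (@sub_finite_set _ _ (\bigcup_(r in [set r | (word_length S r <= R)%N]) E r)).
    move=> p fp; have [a Ca pa] := near p fp; exists ((f * a)^-1 * p).
      by rewrite /= -/(word_dist S _ _) word_distC.
    by split; [case: fp => b _ []|exists a; rewrite // mulVKg].
  apply: bigcup_finite => [|r _]; first exact: finite_ball.
  have [[p1 [Cp1 [a1 Ca1 p1E]]]|no] := pselect (exists p1, E r p1); last first.
    suff -> : E r = set0 by [].
    by apply/seteqP; split=> // p Ep; case: no; exists p.
  apply: sub_finite_set (finite_image (fun x => x * p1) (malC nCf)).
  move=> p [Cp [a Ca pE]]; exists (p * p1^-1); last by rewrite mulgVK.
  split; first by apply: subgroupM => //; apply: subgroupV.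
  exists (a * a1^-1); first by apply: subgroupM => //; apply: subgroupV.
  by rewrite pE p1E !invgM !mulgA mulgK.
have [s sE] := (finite_seqP _).1 fin.
exists (\max_(x <- s) word_length S x).*2%N => p q; rewrite sE => ps qs.
rewrite /word_dist (leq_trans (word_lengthM Sgen _ _)) //.
by rewrite word_lengthV // -addnn leq_add // leq_bigmax_seq.
Qed.

(** A wide shadow has a point p within R of g C. Translating by p^-1 preserves diameters and
    replaces the coset by one with a representative in the ball of radius R, so finitely many cosets
    have to be bounded. *)
Lemma coset_shadow_bounded :
  exists k, forall g, ~ C g -> forall p q,
    coset_shadow g p -> coset_shadow g q -> (d p q <= k)%N.
Proof.
have bd f : exists k, ~ C f -> forall p q,
    coset_shadow f p -> coset_shadow f q -> (d p q <= k)%N.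
  have [Cf|/coset_shadow_bounded1[k kP]] := pselect (C f); first by exists 0%N.
  by exists k.
have [k kP] := choice bd.
have [s sE] := (finite_seqP _).1 (finite_ball Sgen R).
exists (maxn far (\max_(r <- s) k r)) => g nCg p q gp gq.
have [le|lt] := leqP (d p q) far; first by rewrite (leq_trans le) ?leq_maxl.
have [a Ca pa] := coset_shadow_near gp gq lt.
have Cp : C p by case: gp => b _ [].
pose f := p^-1 * (g * a).
have nCf : ~ C f.
  by move=> /(subgroupMl (subgroupV Cp))/(subgroupMr Ca).
have sh x : coset_shadow g x -> coset_shadow f (p^-1 * x).
  move=> gx; apply: coset_shadow_left; first exact: subgroupV.
  exact: coset_shadow_right.
apply: leq_trans (leq_maxr _ _); rewrite -(word_dist_left S p^-1).
apply: leq_trans (kP f nCf _ _ (sh p gp) (sh q gq)) _.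
apply: leq_bigmax_seq => //.
suff : [set` s] f by [].
by rewrite -sE.
Qed.

End CosetProjection.

Lemma coset_projection (G : groupType) (H : subgroup G) :
  hyperbolic_group G -> quasiconvex H -> weakly_malnormal H ->
  exists pr : G -> G,
  [/\ forall g, subgroup_set H (pr g), forall a, subgroup_set H a -> pr a = a,
      forall g a, ~ subgroup_set H g -> subgroup_set H a -> pr (g * a)%g = pr g &
      forall a, finite_set (range (fun g => (pr g)^-1 * pr (g * a))%g)].
Proof.
move=> [S Sgen /gromov_hyperbolic_four_point[delta hyp]] qc mal.
have [K qcK] := quasiconvex_change Sgen hyp qc.
have [k kP] := coset_shadow_bounded Sgen hyp qcK mal.
have [near nearP] := choice (fun x =>
  closest_exists (word_dist S) x (ex_intro _ 1%g (subgroup1 H))).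
have [rep [repC repM rep1]] := left_coset_rep H.
pose pr g := if `[< subgroup_set H g >] then g else near (rep g).
(* On the subgroup both points are g; elsewhere both lie in the shadow of the coset of g. *)
have near_pr g : word_dist S (pr g) (near g) <= k.
  rewrite /pr; case: asboolP => Cg.
    by apply: (@leq_trans 0); rewrite // -(word_distxx Sgen g) (nearP g).2.
  apply: kP Cg _ _ _ _; last by exists 1%g; rewrite ?mulg1 //; apply: subgroup1.
  by exists (g^-1 * rep g)%g; rewrite ?mulVKg.
exists pr; split=> [g|a Ca|g a nCg Ca|a].
- by rewrite /pr; case: asboolP => // _; case: (nearP (rep g)).
- by rewrite /pr asboolT.
- by rewrite /pr !asboolF ?repM // => /(subgroupMr Ca).
pose n := k + (word_length S a + (K.*2 + delta.*2 + 1)) + k.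
apply: sub_finite_set (finite_ball Sgen n) => _ [g _ <-] /=.
rewrite -/(word_dist S _ _) /n.
have := word_dist_triangle Sgen (pr g) (near (g * a)%g) (pr (g * a)%g).
have := word_dist_triangle Sgen (pr g) (near g) (near (g * a)%g).
have := near_pr g; have := near_pr (g * a)%g; rewrite (word_distC Sgen (pr (g * a)%g)).
have := closest_lipschitz (word_distC Sgen) (word_dist_triangle Sgen)
  (word_geodesic Sgen) hyp qcK (nearP g) (nearP (g * a)%g).
by rewrite {2}/word_dist mulKg; lia.
Qed.

(** * Vertex groups embed in the path group *)

Lemma injective_bijective (T U : Type) (f : T -> U) (g : U -> T) :
  injective f -> injective g -> exists h : T -> U, bijective h.
Proof.
move=> finj ginj.
have le (X Z : Type) (k : X -> Z) : injective k -> [set: X] #<= [set: Z].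
  move=> kinj; have [|h] := (@injfunPex _ _ [set: X] [set: Z]).2.
    by exists k => // x z _ _; apply: kinj.
  exact: inj_card_le h.
have /card_bijP[h [h' hK h'K]] := Cantor_Bernstein (le _ _ _ finj) (le _ _ _ ginj).
pose inT (X : Type) (x : X) : set_type [set: X] := exist _ x (mem_set I).
have inTK (X : Type) (x : set_type [set: X]) : inT X (sval x) = x.
  by case: x => x xT; rewrite /inT /=; congr exist; apply: bool_irrelevance.
exists (sval \o h \o inT T); exists (sval \o h' \o inT U) => x.
  by rewrite /= inTK hK.
by rewrite /= inTK h'K.
Qed.

Lemma sequences_absorb (S D : Type) (j : D -> S) (d0 : D) : injective j ->
  exists h : D * (nat -> S) -> (nat -> S), bijective h.
Proof.
move=> jinj.
pose f (x : D * (nat -> S)) n := if n is k.+1 then x.2 k else j x.1.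
pose g (m : nat -> S) := (d0, m).
apply: (@injective_bijective _ _ f g) => [[a m] [b n] ab|m n [//]].
congr pair; first by apply: jinj; have := congr1 (@^~ 0) ab.
by apply/funext => k; have := congr1 (@^~ k.+1) ab.
Qed.

Section VertexGroupInjective.
Local Open Scope group_scope.

(** As a right E-set, A is free with orbits indexed by coset representatives D. Since D embeds in S,
    sequences in S absorb the factor D, and only E remains. *)
Lemma free_orbits (S : Type) (A E : groupType) (i : UMagmaMorphism.type E A)
    (j : A -> S) : injective i -> injective j ->
  exists2 u : A * (nat -> S) -> E * (nat -> S), bijective u &
    forall x m a, u (x * i a, m) = ((u (x, m)).1 * a, (u (x, m)).2).
Proof.
move=> iinj jinj.
have Hcl : group_closed (mem (range i)).
  split; first by rewrite inE; exists 1; rewrite ?gmulf1.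
  by move=> _ _ /set_mem[a _ <-] /set_mem[b _ <-]; rewrite inE; exists (a / b); rewrite ?gmulfF.
have [rep [repC repM _]] := left_coset_rep (Subgroup Hcl).
have /choice[s sP] x : exists a, i a = (rep x)^-1 * x.
  by have [a _ aE] := repC x; exists a^-1; rewrite gmulfV aE invgM invgK.
have rep_rep x : rep (rep x) = rep x.
  by rewrite -{1}(mulVKg x (rep x)) repM.
pose D := {x : A | rep x == x}.
have jDinj : injective (j \o val : D -> S) by move=> x y /jinj/val_inj.
have repP x : rep (rep x) == rep x by rewrite rep_rep.
pose toD x : D := exist (fun z => is_true (rep z == z)) (rep x) (repP x).
have [h [h' hK h'K]] := sequences_absorb (toD 1) jDinj.
exists (fun xm => (s xm.1, h (toD xm.1, xm.2))).
  exists (fun am => (val (h' am.2).1 * i am.1, (h' am.2).2)) => [[x m]|[a m]] /=.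
    by rewrite hK /= sP mulVKg.
  have xE : rep (sval (h' m).1 * i a) = sval (h' m).1.
    by rewrite repM; [exact/eqP/(svalP (h' m).1)|exists a].
  congr pair; first by apply: iinj; rewrite sP xE mulKg.
  rewrite -[RHS]h'K [in RHS](surjective_pairing (h' m)); congr (h (_, _)).
  exact: val_inj.
move=> x m a /=; have ra : rep (x * i a) = rep x by rewrite repM //; exists a.
congr pair; first by apply: iinj; rewrite gmulfM !sP ra mulgA.
by congr (h (_, _)); apply: val_inj.
Qed.

Context (Y : graph) (G : graph_of_groups Y).

(* [path_group G] is made to act on [nat -> S], where every vertex group acts
   freely; the set is so large that the restrictions of these actions to the two
   ends of an edge group are isomorphic. *)
Lemma vcls_inj (v : vert Y) : injective (@vcls Y G v).
Proof.
pose S := {v : vert Y & vgroup G v}; pose M := nat -> S.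
have jinj w : injective (existT (vgroup G) w : _ -> S).
  exact: (@existT_inj2 {classic vert Y}).
have ffP w : exists ff : (vgroup G w * M -> M) * (M -> vgroup G w * M),
    cancel ff.1 ff.2 /\ cancel ff.2 ff.1.
  have [f [f' fK f'K]] := sequences_absorb 1 (@jinj w).
  by exists (f, f').
pose f w := (sval (cid (ffP w))).1; pose f' w := (sval (cid (ffP w))).2.
have fK w : cancel (f w) (f' w) by case: (svalP (cid (ffP w))).
have f'K w : cancel (f' w) (f w) by case: (svalP (cid (ffP w))).
pose act w (g : vgroup G w) (x : M) := f w ((f' w x).1 * g, (f' w x).2).
have act1 w x : act w 1 x = x by rewrite /act mulg1 -surjective_pairing f'K.
have actM w g h x : act w h (act w g x) = act w (g * h) x.
  by rewrite /act fK mulgA.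
(* At each end of an edge the edge group action is identified with right multiplication on the same
   model; an edge letter passes through the model from one end to the other, which forces the edge
   relation. *)
have kkP (eb : edge Y * bool) : exists k : (M -> egroup G eb.1 * M) *
    (egroup G eb.1 * M -> M), [/\ cancel k.1 k.2, cancel k.2 k.1 &
    forall x a, k.1 (act _ (inc G eb.1 eb.2 a) x) = ((k.1 x).1 * a, (k.1 x).2)].
  have [u [u' uK u'K] uM] := free_orbits (@Defs.inc_inj Y G eb.1 eb.2) (@jinj _).
  exists (u \o f' _, f _ \o u'); split=> [x|x|x a] /=.
  - by rewrite uK f'K.
  - by rewrite fK u'K.
  - by rewrite /act fK uM -surjective_pairing.
pose k eb := sval (cid (kkP eb)); have kP eb := svalP (cid (kkP eb)).
pose letter_act (x : M) (l : letter G) : M := match l with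
  | inl s => act _ (projT2 s) x
  | inr (e, b) => (k (e, ~~ b)).2 ((k (e, b)).1 x) end.
have act_equiv u w : word_equiv u w ->
    forall x, foldl letter_act x u = foldl letter_act x w.
  elim=> {u w} [_ _ [p q s t st]|//|u w _ IH x|u w z _ IH1 _ IH2 x].
  - move=> x; rewrite !foldl_cat; congr foldl.
    move: (foldl _ x p) => {}x; case: st => /= [w|w g h|e b|e b a].
    + exact: act1.
    + exact: actM.
    + have [k1 k2 _] := kP (e, b); have [k1' k2' _] := kP (e, ~~ b).
      by rewrite /= negbK k2' k1.
    + have [k1 k2 kM] := kP (e, b); have [k1' k2' kM'] := kP (e, ~~ b).
      by rewrite /= negbK kM' k2' /= -kM k1.
  - by rewrite IH.
  - by rewrite IH1.
pose m0 : M := fun=> existT (vgroup G) v (1 : vgroup G v).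
move=> g h /cls_eqP/act_equiv/(_ (f v (1 : vgroup G v, m0))) /=.
by rewrite /act !fK /= !mul1g => /(can_inj (fK v))[].
Qed.

End VertexGroupInjective.

(** * Retraction of a star amalgam onto its centre *)

Section AmalgamRetraction.
Local Open Scope group_scope.
Context (Y : graph) (G : graph_of_groups Y).
Local Notation F := (path_group G).
Context (H : subgroup F) (pr : vert Y -> F -> F).
Local Notation P := (subgroup_set H).
Local Notation V v := (range (@vcls Y G v)).

Hypothesis P_ecls : forall e b, P (ecls G e b).
Hypothesis P_inc : forall e b a, P (vcls (inc G e b a)).
Hypothesis P_gen : forall x, P x ->
  exists2 w : seq (letter G), (forall l, l \in w -> P (cls [:: l])) & x = cls w.

Hypothesis pr_sub : forall v x, V v x -> P (pr v x).
Hypothesis pr_id : forall v x, V v x -> P x -> pr v x = x.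
Hypothesis pr_coset : forall v x c,
  V v x -> ~ P x -> V v c -> P c -> pr v (x * c) = pr v x.
Hypothesis pr_finite : forall v a, V v a ->
  finite_set [set (pr v x)^-1 * pr v (x * a) | x in V v].

Lemma vclsV v (g : vgroup G v) : vcls g^-1 = (vcls g)^-1.
Proof. by apply: (mulIg (vcls g)); rewrite -vclsM !mulVg vcls1. Qed.

Lemma vcls_group_closed v : group_closed (mem (V v)).
Proof.
split; first by rewrite inE; exists 1; rewrite ?vcls1.
move=> _ _ /set_mem[a _ <-] /set_mem[b _ <-]; rewrite inE; exists (a / b) => //.
by rewrite vclsM vclsV.
Qed.
Let A v : subgroup F := Subgroup (vcls_group_closed v).

Lemma setI_group_closed v : group_closed (mem (V v `&` P)).
Proof.
split; first by rewrite inE; split; [exact: (subgroup1 (A v))|exact: subgroup1].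
move=> x y /set_mem[Ax Px] /set_mem[Ay Py]; rewrite inE; split.
  by apply: (@subgroupM _ (A v)) => //; apply: (@subgroupV _ (A v)).
by apply: subgroupM => //; apply: subgroupV.
Qed.
Let Csub v : subgroup F := Subgroup (setI_group_closed v).
Local Notation C v := (subgroup_set (Csub v)).

Context (tau : vert Y -> F -> F).
Hypothesis tauC : forall v x, C v (x^-1 * tau v x).
Hypothesis tauM : forall v x c, C v c -> tau v (x * c) = tau v x.
Hypothesis tau1 : forall v c, C v c -> tau v c = 1.

(* A state [([:: (q_k, v_k, b_k); ...; (q_1, v_1, b_1)], p)] encodes the
   normal form [q_1 b_1 ... q_k b_k p] of the amalgam of [P] with the vertex
   groups over the subgroups [C v], with coset representatives [q_i], [b_i]. *)
Definition state : Type := (seq (F * vert Y * F) * F)%type.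

Definition head_at (st : seq (F * vert Y * F)) (v : vert Y) : Prop :=
  if st is (_, w, _) :: _ then w = v else False.

Fixpoint reduced (st : seq (F * vert Y * F)) : Prop :=
  if st is (q, v, b) :: st' then
    [/\ reduced st', P q, tau v q = q & ~ (head_at st' v /\ q = 1)] /\
    [/\ V v b, ~ P b & tau v b = b]
  else True.

Definition valid (s : state) : Prop := reduced s.1 /\ P s.2.

(** What is left of a normal form once its trailing factor at v is removed; the last clause forbids
    adjacent syllables at v with nothing between them. *)
Definition valid_key (v : vert Y) (k : state) : Prop :=
  [/\ reduced k.1, P k.2, tau v k.2 = k.2 & ~ (head_at k.1 v /\ k.2 = 1)].

(** With [join_at] this identifies valid states with pairs of a valid key and an element of the
    vertex group, which then acts by right multiplication on the second factor. The last syllable is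
    absorbed only when it belongs to v and p lies in [C v]; otherwise only the [C v] part of p is
    split off. *)
Definition split_at (v : vert Y) (s : state) : state * F :=
  match s with
  | ((q, w, b) :: st, p) =>
      if `[< w = v /\ C v p >] then ((st, q), b * p)
      else ((s.1, tau v p), (tau v p)^-1 * p)
  | ([::], p) => (([::], tau v p), (tau v p)^-1 * p)
  end.

Definition join_at (v : vert Y) (k : state) (a : F) : state :=
  if `[< P a >] then (k.1, k.2 * a)
  else ((k.2, v, tau v a) :: k.1, (tau v a)^-1 * a).

Lemma tau_eq1 v x : tau v x = 1 -> C v x.
Proof. by move=> x1; have := tauC v x; rewrite x1 mulg1; apply: subgroupVr. Qed.

Lemma tau_tau v x : tau v (tau v x) = tau v x.
Proof. by rewrite -{1}(mulVKg x (tau v x)) tauM. Qed.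

Lemma tauVC v x : C v ((tau v x)^-1 * x).
Proof. by apply: subgroupVr; rewrite invgM invgK. Qed.

Lemma V_tau v x : V v x -> V v (tau v x).
Proof.
move=> Vx; rewrite -(mulVKg x (tau v x)); apply: (@subgroupM _ (A v)) => //.
by have [] := tauC v x.
Qed.

Lemma P_tau v x : P x <-> P (tau v x).
Proof.
have [_ Pt] := tauVC v x; split=> Px; last first.
  by rewrite -(mulVKg (tau v x) x); apply: subgroupM.
by rewrite -(mulVKg x (tau v x)); apply: subgroupM => //; have [] := tauC v x.
Qed.

Lemma split_at_valid v s :
  valid s -> valid_key v (split_at v s).1 /\ V v (split_at v s).2.
Proof.
case: s => [[|[[q w] b] st] p] /= [red Pp].
  by split; [split=> //=; [exact: (P_tau v p).1|exact: tau_tau|case]|have [] := tauVC v p].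
case: asboolP => [[wv Cp]|nC] /=; last first.
  split; last by have [] := tauVC v p.
  split=> //=; [exact: (P_tau v p).1|exact: tau_tau|].
  by move=> [wv t1]; apply: nC; split; last exact: tau_eq1.
subst w; case: red => [key [Vb nPb bE]]; split=> //.
by apply: (@subgroupM _ (A v)) => //; case: Cp.
Qed.

Lemma join_at_valid v k a : valid_key v k -> V v a -> valid (join_at v k a).
Proof.
case: k => st q [/= red Pq qE hd] Va; rewrite /join_at; case: asboolP => /= Pa.
  by split=> //=; apply: subgroupM.
split=> /=; last by have [] := tauVC v a.
by split=> //; split; [exact: V_tau|rewrite -P_tau|exact: tau_tau].
Qed.

Lemma join_split_at v s : valid s ->
  join_at v (split_at v s).1 (split_at v s).2 = s.
Proof.
have easy st p : join_at v (st, tau v p) ((tau v p)^-1 * p) = (st, p).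
  by rewrite /join_at asboolT ?mulVKg //; have [] := tauVC v p.
case: s => [[|[[q w] b] st] p] /= [red Pp]; first exact: easy.
case: asboolP => [[wv Cp]|nC] /=; last exact: easy.
subst w; case: red => [key [Vb nPb bE]]; rewrite /join_at asboolF /=.
  by rewrite tauM // bE mulKg.
by move=> /(subgroupMr Cp.2).
Qed.

Lemma split_join_at v k a : valid_key v k -> V v a ->
  split_at v (join_at v k a) = (k, a).
Proof.
case: k => st q [/= red Pq qE hd] Va; rewrite /join_at; case: asboolP => /= Pa.
  have Ca : C v a by [].
  case: st red hd => [|[[q' w] b] st] red hd /=; first by rewrite tauM // qE mulKg.
  rewrite asboolF; first by rewrite tauM // qE mulKg.
  move=> [wv /(subgroupMr Ca) Cq]; apply: hd; split=> //.
  by rewrite -qE tau1.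
by rewrite asboolT ?mulVKg //; split=> //; apply: tauVC.
Qed.

Lemma join_atM v k a c : C v c ->
  join_at v k (a * c) = ((join_at v k a).1, (join_at v k a).2 * c).
Proof.
move=> Cc; rewrite /join_at; case: asboolP => Pac; case: asboolP => Pa /=.
- by rewrite mulgA.
- by case: Pa; apply: subgroupMr Pac; case: Cc.
- by case: Pac; apply: subgroupM => //; case: Cc.
- by rewrite tauM // mulgA.
Qed.

Definition act_at (v : vert Y) (a : F) (s : state) : state :=
  join_at v (split_at v s).1 ((split_at v s).2 * a).

Definition step (s : state) (l : letter G) : state :=
  match l with
  | inl sg => act_at (projT1 sg) (vcls (projT2 sg)) s
  | inr (e, b) => (s.1, s.2 * ecls G e b)
  end.

Lemma act_at_valid v a s : V v a -> valid s -> valid (act_at v a s).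
Proof.
move=> Va /(split_at_valid v)[key Vx]; apply: join_at_valid => //.
exact: (@subgroupM _ (A v)).
Qed.

Lemma act_atM v a b s : V v a -> V v b -> valid s ->
  act_at v b (act_at v a s) = act_at v (a * b) s.
Proof.
move=> Va Vb /(split_at_valid v)[key Vx].
rewrite /act_at split_join_at ?mulgA //; exact: (@subgroupM _ (A v)).
Qed.

Lemma act_atC v c s : V v c -> P c -> valid s -> act_at v c s = (s.1, s.2 * c).
Proof. by move=> Vc Pc ok; rewrite /act_at join_atM // join_split_at. Qed.

Lemma step_valid s l : valid s -> valid (step s l).
Proof.
case: l => [[v g]|[e b]] ok /=; first by apply: act_at_valid => //; exists g.
by case: ok => red Ps; split=> //=; apply: subgroupM.
Qed.

Lemma steps_valid s w : valid s -> valid (foldl step s w).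
Proof. by elim: w s => //= l w IH s ok; apply/IH/step_valid. Qed.

Lemma step_P s l : valid s -> P (cls [:: l]) ->
  step s l = (s.1, s.2 * cls [:: l]).
Proof. by case: l => [[v g]|[e b]] ok //= Pl; apply: act_atC => //; exists g. Qed.

Lemma steps_P s w : valid s -> (forall l, l \in w -> P (cls [:: l])) ->
  foldl step s w = (s.1, s.2 * cls w).
Proof.
elim: w s => [|l w IH] s ok Pw /=; first by rewrite mulg1; case: s ok.
have Pl := Pw l (mem_head _ _); rewrite IH; first last.
- by move=> x xw; apply: Pw; rewrite inE xw orbT.
- exact: step_valid.
by rewrite step_P //= -mulgA -clsM.
Qed.

(** Edge letters and images of edge groups lie in P, where every letter acts by right multiplication
    on the last entry; the edge relations therefore hold already in the group. *)
Lemma relator_steps u w s : relator u w -> valid s ->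
  foldl step s u = foldl step s w.
Proof.
case=> [v|v g h|e b|e b a] ok /=.
- have V1 : V v 1 by exists 1; rewrite ?vcls1.
  by rewrite vcls1 act_atC ?mulg1; [case: (s)| |exact: subgroup1|].
- have Vg : V v (vcls g) by exists g.
  have Vh : V v (vcls h) by exists h.
  by rewrite act_atM ?vclsM.
- rewrite -mulgA.
  suff -> : ecls G e b * ecls G e (~~ b) = 1 by rewrite mulg1; case: (s).
  by rewrite -clsM; apply/cls_eqP/relator_equiv/rel_inv.
- have [red Ps] := ok.
  have ok' : valid (s.1, s.2 * ecls G e b) by split=> //; apply: subgroupM.
  have Vinc c : V (endpt e c) (vcls (inc G e c a)) by exists (inc G e c a).
  have Pinc c := P_inc c a.
  rewrite !act_atC // /=.
  congr pair; rewrite -!mulgA; congr (_ * _).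
  rewrite /vcls /ecls -(clsM [:: _] [:: _]) -(clsM [:: _] [:: _; _]).
  exact/cls_eqP/relator_equiv/(rel_edge b a).
Qed.

Lemma word_equiv_steps u w s : word_equiv u w -> valid s ->
  foldl step s u = foldl step s w.
Proof.
move=> uw ok; elim: uw => {u w} [_ _ [p q u w uw]|//|u w _ -> //|u w z _ -> _ -> //].
by rewrite !foldl_cat (relator_steps uw) //; apply: steps_valid.
Qed.

(** Syllables are stacked with the newest first, so [last] returns the first syllable of the normal
    form. *)
Definition bottom (s : state) : F :=
  if s.1 is x :: st then (last x st).1.1 * pr (last x st).1.2 (last x st).2
  else s.2.

(** Constancy of [pr] on cosets outside P, and its being the identity on P, make the value
    independent of how [join_at] stores a. *)
Lemma bottom_join_at v k a : V v a ->
  bottom (join_at v k a) = if k.1 is [::] then k.2 * pr v a else bottom k.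
Proof.
case: k => st q Va; rewrite /join_at; case: asboolP => Pa; case: st => //=.
  by rewrite /bottom /= pr_id.
rewrite /bottom /=; have [VtC PtC] := tauC v a.
by rewrite -(pr_coset Va Pa VtC PtC) mulVKg.
Qed.

Lemma bottom_P s : valid s -> P (bottom s).
Proof.
case: s => [[|x st] p] []; first by rewrite /bottom.
move=> + _ /=.
rewrite /bottom /=; elim: st x => [|y st IH] [[q v] b] /=.
  by move=> [[_ Pq _ _] [Vb _ _]]; apply: subgroupM => //; apply: pr_sub.
by move=> [[red _ _ _] _]; apply: IH.
Qed.

(** A letter alters [bottom] only when no syllable lies beneath it: a vertex letter a turns [pr v x]
    into [pr v (x * a)], and an edge letter multiplies by itself. Longer words compose such
    changes. *)
Lemma bottom_steps_finite w :
  finite_set [set (bottom s)^-1 * bottom (foldl step s w) | s in valid].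
Proof.
elim: w => [|l w IH].
  apply: sub_finite_set (finite_set1 1) => _ [s _ <-] /=.
  by rewrite mulVg.
have fl : finite_set [set (bottom s)^-1 * bottom (step s l) | s in valid].
  case: l => [[v g]|[e b]] /=.
    have Vg : V v (vcls g) by exists g.
    have fin : finite_set ([set 1] `|`
        [set (pr v x)^-1 * pr v (x * vcls g) | x in V v]).
      by rewrite finite_setU; split; [exact: finite_set1|exact: pr_finite].
    apply: sub_finite_set fin => _ [s ok <-].
    have [key Vx] := split_at_valid v ok; rewrite -{1}(join_split_at v ok) /act_at.
    move: (split_at v s) key Vx => [[st q] x] /= key Vx.
    rewrite !bottom_join_at //; last exact: (@subgroupM _ (A v)).
    case: st {key} => [|y st] /=; last by left; rewrite mulVg.
    by right; exists x; rewrite // invgM -!mulgA mulKg.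
  apply: sub_finite_set (finite_set2 1 (ecls G e b)) => _ [[st p] ok <-].
  rewrite /bottom /=; case: st {ok} => [|x st] /=; first by right; rewrite mulKg.
  by left; rewrite mulVg.
apply: sub_finite_set (finite_image2 (fun x y => x * y) fl IH) => _ [s ok <-] /=.
exists ((bottom s)^-1 * bottom (step s l)); first by exists s.
exists ((bottom (step s l))^-1 * bottom (foldl step (step s l) w)).
  by exists (step s l) => //; apply: step_valid.
by rewrite mulgA mulgK.
Qed.

Lemma amalgam_retraction_of_reps : exists rho : F -> F,
  [/\ forall x, P (rho x), forall x, P x -> rho x = x &
      forall s, finite_set (range (fun x => (rho x)^-1 * rho (x * s)))].
Proof.
have ok0 : valid ([::], 1) by split=> //; apply: subgroup1.
exists (fun x => bottom (foldl step ([::], 1) (repr x))).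
split=> [x|x Px|s]; first exact/bottom_P/steps_valid.
  have [w wP ->] := P_gen Px.
  by rewrite (word_equiv_steps (repr_cls w)) // steps_P // mul1g.
apply: sub_finite_set (bottom_steps_finite (repr s)) => _ [x _ <-].
exists (foldl step ([::], 1) (repr x)); first exact: steps_valid.
have xs : word_equiv (repr (x * s)) (repr x ++ repr s).
  by apply/cls_eqP; rewrite clsM !clsK.
by rewrite (word_equiv_steps xs) // foldl_cat.
Qed.

End AmalgamRetraction.

Lemma amalgam_retraction (Y : graph) (G : graph_of_groups Y)
    (H : subgroup (path_group G)) (pr : vert Y -> path_group G -> path_group G) :
  (forall e b, subgroup_set H (ecls G e b)) ->
  (forall e b a, subgroup_set H (vcls (inc G e b a))) ->
  (forall x, subgroup_set H x -> exists2 w : seq (letter G),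
    (forall l, l \in w -> subgroup_set H (cls [:: l])) & x = cls w) ->
  (forall v x, range (@vcls Y G v) x -> subgroup_set H (pr v x)) ->
  (forall v x, range (@vcls Y G v) x -> subgroup_set H x -> pr v x = x) ->
  (forall v x c, range (@vcls Y G v) x -> ~ subgroup_set H x ->
    range (@vcls Y G v) c -> subgroup_set H c -> pr v (x * c)%g = pr v x) ->
  (forall v a, range (@vcls Y G v) a ->
    finite_set [set (pr v x)^-1 * pr v (x * a) | x in range (@vcls Y G v)]%g) ->
  exists rho : path_group G -> path_group G,
  [/\ forall x, subgroup_set H (rho x),
      forall x, subgroup_set H x -> rho x = x &
      forall s, finite_set (range (fun x => (rho x)^-1 * rho (x * s))%g)].
Proof.
move=> Hecls Hinc Hgen pr1 pr2 pr3 pr4.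
have /choice[tau tauP] v := left_coset_rep (Subgroup (setI_group_closed H v)).
apply: (amalgam_retraction_of_reps Hecls Hinc Hgen pr1 pr2 pr3 pr4 (tau := tau)).
- by move=> v x; case: (tauP v) => + _ _; apply.
- by move=> v x c; case: (tauP v) => _ + _; apply.
- by move=> v c; case: (tauP v) => _ _; apply.
Qed.

(** * Comparison of the two fundamental groups *)

Section Contraction.
Local Open Scope group_scope.
Context (Y : graph) (G : graph_of_groups Y) (v0 : vert Y).

Lemma path_classV u v x : path_class G u v x -> path_class G v u x^-1.
Proof.
move=> [w wP ->]; exists (word_inv w); first exact: is_path_inv.
by rewrite clsV.
Qed.

Lemma connected_paths : connected Y -> exists t : vert Y -> path_group G,
  (forall v, path_class G v0 v (t v)) /\ t v0 = 1.
Proof.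
move=> [_ conn].
have path u v : exists x, path_class G u v x.
  elim: (conn u v) => {u v} [_ _ [e [-> ->]]|u|u v _ [x xP]|u v w _ [x xP] _ [y yP]].
  - by exists (ecls G e false); apply: path_class_ecls.
  - by exists 1, [::].
  - by exists x^-1; apply: path_classV.
  - by exists (x * y); apply: path_classM yP.
have [t tP] := choice (path v0).
exists (fun v => (t v0)^-1 * t v); split; last by rewrite mulVg.
by move=> v; apply: path_classM (tP v); apply: path_classV.
Qed.

Context (t : vert Y -> path_group G).
Hypothesis tP : forall v, path_class G v0 v (t v).

Definition contract_letter (l : letter G) : path_group G :=
  t (letter_src l) * cls [:: l] * (t (letter_tgt l))^-1.

Definition contract_word (w : seq (letter G)) : path_group G :=
  \prod_(l <- w) contract_letter l.

Lemma contract_word_path u w v : is_path u w v ->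
  contract_word w = t u * cls w * (t v)^-1.
Proof.
rewrite /contract_word.
elim: w u => [|l w IH] u /=; first by move->; rewrite big_nil mulg1 mulgV.
move=> [<- /IH]; rewrite big_cons => ->.
by rewrite /contract_letter (clsM [:: l] w) !mulgA mulgVK.
Qed.

Lemma relator_path p q : relator (G := G) p q ->
  exists u v, is_path u p v /\ is_path u q v.
Proof.
case=> [v|v g h|e b|e b a]; first by exists v, v.
- by exists v, v.
- by exists (endpt e b), (endpt e b); rewrite /= negbK.
- by exists (endpt e b), (endpt e b); rewrite /= negbK.
Qed.

(** The two sides of a relator read along paths with common ends, and along a path the inner factors
    t cancel. *)
Lemma contract_word_equiv u w : word_equiv u w ->
  contract_word u = contract_word w.
Proof.
elim=> {u w} [_ _ [p q u w uw]|//|u w _ -> //|u w z _ -> _ -> //].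
rewrite /contract_word !big_cat; congr (_ * (_ * _)).
have [x [y [ux wx]]] := relator_path uw.
rewrite -!/(contract_word _) (contract_word_path ux) (contract_word_path wx).
by rewrite (_ : cls u = cls w) //; apply/cls_eqP/relator_equiv.
Qed.

(* Collapsing the tree of paths [t v] retracts Serre's group onto the
   fundamental group at [v0]. *)
Definition contract (x : path_group G) : path_group G := contract_word (repr x).

Lemma contract_cls w : contract (cls w) = contract_word w.
Proof. exact/contract_word_equiv/repr_cls. Qed.

Lemma contractM x y : contract (x * y) = contract x * contract y.
Proof.
rewrite -(clsK x) -(clsK y) -clsM !contract_cls.
by rewrite /contract_word big_cat.
Qed.

Lemma contract_path u v x : path_class G u v x ->
  contract x = t u * x * (t v)^-1.
Proof. by move=> [w wP ->]; rewrite contract_cls; apply: contract_word_path. Qed.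

Lemma contract_loop x : path_class G v0 v0 (contract x).
Proof.
rewrite /contract /contract_word; elim: (repr x) => [|l w IH].
  by rewrite big_nil; exists [::].
rewrite big_cons; apply: path_classM IH.
apply: path_classM (path_classV (tP _)); apply: path_classM (tP _) _.
by exists [:: l].
Qed.

End Contraction.

Section Inclusion.
Local Open Scope group_scope.
Context (Y : graph) (G : graph_of_groups Y) (Y' : subgraph Y)
  (G' : subgroups_over G Y') (v0 : vert Y').
Local Notation sG := (sub_graph_of_groups G').
Local Notation incl := (@path_group_incl Y G Y' G').

Lemma path_group_inclV x : incl x^-1 = (incl x)^-1.
Proof.
by apply: (mulIg (incl x)); rewrite -path_group_inclM !mulVg path_group_incl1.
Qed.

Lemma path_group_incl_closed : group_closed (mem (range incl)).
Proof.
split; first by rewrite inE; exists 1; rewrite ?path_group_incl1.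
move=> _ _ /set_mem[a _ <-] /set_mem[b _ <-]; rewrite inE; exists (a / b) => //.
by rewrite path_group_inclM path_group_inclV.
Qed.
Definition incl_subgroup : subgroup (path_group G) :=
  Subgroup path_group_incl_closed.

Lemma incl_subgroup_gen x : subgroup_set incl_subgroup x ->
  exists2 w : seq (letter G), (forall l, l \in w -> subgroup_set incl_subgroup (cls [:: l])) &
    x = cls w.
Proof.
move=> [y _ <-]; exists (map (@letter_incl _ _ _ G') (repr y)) => //.
move=> _ /mapP[l _ ->]; exists (cls [:: l]) => //.
exact: path_group_incl_cls.
Qed.

Lemma contract_incl (t : vert Y -> path_group G) (t' : vert Y' -> path_group sG) x :
  (forall v, t (sval v) = incl (t' v)) ->
  contract t (incl x) = incl (contract t' x).
Proof.
move=> tt'; rewrite -(clsK x) path_group_incl_cls !contract_cls /contract_word.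
elim: (repr x) => [|l w IH]; first by rewrite !big_nil path_group_incl1.
rewrite /= !big_cons path_group_inclM -IH; congr (_ * _).
rewrite /contract_letter 2!path_group_inclM path_group_inclV path_group_incl_cls.
by rewrite -!tt'; case: l => [[v g]|[e b]].
Qed.

Lemma tree_vmap_coset (v : vert Y') z :
  tree_vmap_fun (G' := G') (v, vcoset v [set z]) =
  (sval v, vcoset (sval v) [set incl z]).
Proof.
congr pair; apply/seteqP; split=> y /=.
- move=> [_ [g [[_ [_ [h [-> ->]]] <-] ->]]].
  exists (incl z), (val (h : subgroup_type (sub_vgroup G' v)) * g); split=> //.
  by rewrite path_group_inclM path_group_incl_vcls vclsM mulgA.
- move=> [_ [g [-> ->]]]; exists (incl z), g; split=> //.
  by exists z => //; exists z, 1; split=> //; rewrite vcls1 mulg1.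
Qed.

End Inclusion.

(** * Transfer between Serre's group and the fundamental group *)

Section EqualEdgeGroups.
Local Open Scope group_scope.
Context (Y : graph) (G : graph_of_groups Y) (Y' : subgraph Y)
  (G' : subgroups_over G Y') (v0 : vert Y').
Local Notation sG := (sub_graph_of_groups G').
Local Notation incl := (@path_group_incl Y G Y' G').
Local Notation P := (subgroup_set (incl_subgroup G')).
Local Notation C v := (subgroup_set (sub_vgroup G' v)).
Local Notation pi := (pi1 G (sval v0)).
Local Notation H := (range (@pi1_incl Y G Y' G' v0)).

Context (t : vert Y -> path_group G) (t' : vert Y' -> path_group sG).
Hypothesis t'P : forall v, path_class sG v0 v (t' v).
Hypothesis tt' : forall v, t (sval v) = incl (t' v).
Hypothesis tP : forall v, path_class G (sval v0) v (t v).
Hypothesis t1 : t (sval v0) = 1.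
Hypothesis vmap_inj : injective (vmap (tree_incl G' v0)).

Definition to_pi1 (x : path_group G) : pi :=
  exist _ (contract t x) (mem_set (contract_loop tP x)).

Lemma to_pi1M x y : to_pi1 (x * y) = to_pi1 x * to_pi1 y.
Proof. by apply: val_inj; rewrite /= contractM. Qed.

Lemma to_pi1V x : to_pi1 x^-1 = (to_pi1 x)^-1.
Proof.
apply: (mulIg (to_pi1 x)); rewrite -to_pi1M !mulVg; apply: val_inj => /=.
by rewrite -cls1 contract_cls /contract_word big_nil.
Qed.

Lemma to_pi1K (x : pi) : to_pi1 (sval x) = x.
Proof.
apply: val_inj; rewrite /= (contract_path t (subgroup_memP x)) t1.
by rewrite mul1g invg1 mulg1.
Qed.

Lemma to_pi1_incl x : P x -> H (to_pi1 x).
Proof.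
move=> [y _ <-].
exists (exist _ (contract t' y) (mem_set (contract_loop t'P y))) => //.
by apply: val_inj; rewrite /= (contract_incl _ tt').
Qed.

Lemma range_pi1_incl (x : pi) : H x <-> P (sval x).
Proof.
split=> [[y _ <-]|/to_pi1_incl]; first by exists (sval y).
by rewrite to_pi1K.
Qed.

(** Contracting a preimage of g gives a loop y whose image is g conjugated by t v. The cosets of t'
    v and of y t' v are vertices of the smaller tree with the same image, as t v g and t v differ by
    g. Injectivity yields y t' v = t' v h with h in the subgroup, and [vcls_inj] gives g = h. *)
Lemma incl_subgroup_vcls (v : vert Y') (g : vgroup G (sval v)) :
  P (vcls g) <-> C v g.
Proof.
split=> [[x _ xg]|Cg]; last first.
  exists (vcls (exist _ g (mem_set Cg) : vgroup sG v)) => //.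
  exact: path_group_incl_vcls.
set y := contract t' x.
have yE : incl y = t (sval v) * vcls g * (t (sval v))^-1.
  rewrite -(contract_incl _ tt') xg.
  exact: (contract_path t (path_class_vcls g)).
have tv z (zP : path_class sG v0 v z) : tree_verts sG v0 (v, vcoset v [set z]).
  by exists z.
pose node z (zP : path_class sG v0 v z) : vert (bass_serre_tree sG v0) :=
  exist (fun x => is_true (x \in tree_verts sG v0)) _ (mem_set (tv z zP)).
have yt' : path_class sG v0 v (y * t' v).
  exact: path_classM (contract_loop t'P x) (t'P v).
have eqv : vmap (tree_incl G' v0) (node _ (t'P v)) =
           vmap (tree_incl G' v0) (node _ yt').
  apply: val_inj => /=; rewrite !tree_vmap_coset; congr pair.
  rewrite path_group_inclM yE -tt' mulgVK.
  apply/seteqP; split=> _ [_ [h [-> ->]]] /=.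
    exists (t (sval v) * vcls g), (g^-1 * h); split=> //.
    by rewrite -mulgA -vclsM mulVKg.
  by exists (t (sval v)), (g * h); split=> //; rewrite vclsM mulgA.
have /(congr1 snd)/= cosetE := congr1 sval (vmap_inj eqv).
have : vcoset v [set y * t' v] (y * t' v).
  by exists (y * t' v), 1; rewrite vcls1 mulg1.
rewrite -cosetE => -[_ [h [-> ytE]]].
have := congr1 incl ytE.
rewrite !path_group_inclM yE -!tt' mulgVK path_group_incl_vcls.
by move=> /mulgI/vcls_inj ->; apply: subgroup_memP.
Qed.

(** Conjugation by t v embeds the vertex group in the fundamental group, and H pulls back to [C v]
    because t v itself lies in P. *)
Lemma weakly_malnormal_vertex (v : vert Y') :
  weakly_malnormal H -> weakly_malnormal (C v).
Proof.
move=> mal g nCg.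
pose j (x : vgroup G (sval v)) := to_pi1 (vcls x).
have jinj : injective j.
  move=> x y /(congr1 sval) /=.
  rewrite !(contract_path t (path_class_vcls _)).
  by move=> /mulIg/mulgI/vcls_inj.
have jH x : H (j x) <-> C v x.
  rewrite -incl_subgroup_vcls; split=> [/range_pi1_incl|]; last exact: to_pi1_incl.
  rewrite /= (contract_path t (path_class_vcls x)) tt'.
  have Pt : P (incl (t' v)) by exists (t' v).
  by move=> /(subgroupMr (subgroupV Pt))/(subgroupMl Pt).
have nHg : ~ H (j g) by move=> /jH.
apply: sub_finite_set (finite_preimage (f := j) _ (mal _ nHg)); last first.
  by move=> x y _ _; apply: jinj.
move=> x [Cx [a Ca axg]]; split; first exact/jH.
exists (j a); first exact/jH.
by rewrite -axg /j !vclsM vclsV !to_pi1M to_pi1V.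
Qed.

Hypothesis allv : forall v, v \in subvert Y'.
Hypothesis alle : forall e, e \in subedge Y'.
Hypothesis edges : forall e : edge Y', subgroup_set (sub_egroup G' e) = setT.

Lemma quasiconvex_of_vertex_projections :
  hyperbolic_group pi ->
  (forall v : vert Y', exists pr : vgroup G (sval v) -> vgroup G (sval v),
    [/\ forall g, C v (pr g), forall a, C v a -> pr a = a,
        forall g a, ~ C v g -> C v a -> pr (g * a) = pr g &
        forall a, finite_set (range (fun g => (pr g)^-1 * pr (g * a)))]) ->
  quasiconvex H.
Proof.
move=> hyp prex.
pose up (v : vert Y) : vert Y' := exist _ v (allv v).
pose upe (e : edge Y) : edge Y' := exist _ e (alle e).
pose prG v : vgroup G v -> vgroup G v := sval (cid (prex (up v))).
have prGP v := svalP (cid (prex (up v))).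
(* By [vcls_inj], [xget] inverts [vcls] on its range; elsewhere it returns the filler 1. *)
pose pr v x := vcls (prG v (xget 1 [set g | vcls g = x])).
have prE v g : pr v (vcls g) = vcls (prG v g).
  rewrite /pr; congr (vcls (prG v _)).
  by case: xgetP => [h _ /vcls_inj //|/(_ g)[]].
have PC v (g : vgroup G v) : P (vcls g) <-> C (up v) g.
  exact: (@incl_subgroup_vcls (up v)).
have [|||||||rho [rhoP rhoid rhofin]] :=
    @amalgam_retraction Y G (incl_subgroup G') pr.
- by move=> e b; exists (ecls sG (upe e) b); rewrite ?path_group_incl_ecls.
(* Equality of edge groups enters here: it puts every edge group of [G] inside the centre. *)
- move=> e b a; apply/(@incl_subgroup_vcls (endpt (upe e) b)).
  by apply: (sub_inc (e := upe e)); rewrite edges.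
- exact: incl_subgroup_gen.
- move=> v _ [g _ <-]; rewrite prE; apply/PC.
  by case: (prGP v) => + _ _ _; apply.
- move=> v _ [g _ <-] /PC Cg; rewrite prE; congr vcls.
  by case: (prGP v) => _ + _ _; apply.
- move=> v _ _ [g _ <-] nP [c _ <-] /PC Cc; rewrite -vclsM !prE; congr vcls.
  by case: (prGP v) => _ _ + _; apply=> // /PC.
- move=> v _ [a _ <-]; case: (prGP v) => _ _ _ /(_ a) fin.
  apply: sub_finite_set (finite_image (@vcls Y G v) fin) => _ [_ [g _ <-] <-].
  exists ((prG v g)^-1 * prG v (g * a)); first by exists g.
  by rewrite vclsM vclsV -vclsM !prE.
(* [rho] need not send loops to loops; contracting afterwards repairs this, fixes H, and keeps
   finiteness because [to_pi1] is a homomorphism. *)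
pose r (x : pi) : pi := to_pi1 (rho (sval x)).
apply: (@quasiconvex_of_retraction pi H r hyp).
- by move=> x; apply/to_pi1_incl/rhoP.
- by move=> x /range_pi1_incl Px; rewrite /r rhoid ?to_pi1K.
- move=> s.
  apply: sub_finite_set (finite_image to_pi1 (rhofin (sval s))) => _ [x _ <-].
  exists ((rho (sval x))^-1 * rho (sval x * sval s)); first by exists (sval x).
  by rewrite /r to_pi1M to_pi1V.
Qed.

End EqualEdgeGroups.

Theorem theoremG (Y : graph) (G : graph_of_groups Y)
    (Y' : subgraph Y) (G' : subgroups_over G Y') (v0 : vert Y')
    (Yfin : finite_graph Y) (Yconn : connected Y)
    (Gqi : qi_embedded_condition G)
    (pi1_hyp : hyperbolic_group (pi1 G (sval v0)))
    (G'sub : subgraph_of_subgroups G' v0)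
    (G'qi : qi_embedded_condition (sub_graph_of_groups G'))
    (H1 : subvert Y' = setT /\ subedge Y' = setT)
    (H2 : forall u : vert Y', quasiconvex (subgroup_set (sub_vgroup G' u)))
    (H3 : forall e : edge Y', subgroup_set (sub_egroup G' e) = setT) :
  weakly_malnormal (range (@pi1_incl Y G Y' G' v0)) ->
  quasiconvex (range (@pi1_incl Y G Y' G' v0)).
Proof.
move=> mal; have [conn [vinj _]] := G'sub.
have allv v : v \in subvert Y' by rewrite H1.1 inE.
have alle e : e \in subedge Y' by rewrite H1.2 inE.
pose up (v : vert Y) : vert Y' := exist _ v (allv v).
have upK v : up (sval v) = v by apply: val_inj.
have [t' [t'P t'1]] := connected_paths (sub_graph_of_groups G') v0 conn.
pose t v := path_group_incl (t' (up v)).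
have tt' v : t (sval v) = path_group_incl (t' v) by rewrite /t upK.
have tP v : path_class G (sval v0) v (t v).
  exact: (path_class_incl (t'P (up v))).
have t1 : t (sval v0) = 1%g by rewrite tt' t'1 path_group_incl1.
apply: (quasiconvex_of_vertex_projections t'P tt' tP t1 vinj allv alle H3) => //.
move=> v; case: Gqi => hypv _ _; apply: coset_projection (hypv _) (H2 v) _.
exact: (weakly_malnormal_vertex t'P tt' tP t1 vinj).
Qed.
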